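(* There exists a constant $C>0$ such that the following is true. Let $B$ be a finite set and let $V$ be a linear subspace (over $\mathbb{Q}$) of functions $f:B\to\mathbb{Q}$. Assume that the following conditions hold for some integers $c_1,c_2,c_3\ge1$: (1) Divisibility: $c_1$ is the divisibility constant of $V$. (2) Boundedness of $V$: $V$ has a $c_2$-bounded integer basis in $\ell_\infty$. (3) Boundedness of $V^\perp$: $V^\perp$ has a $c_3$-bounded integer basis in $\ell_1$. (4) Symmetry: for any $b_1,b_2\in B$ there exists a symmetry $\pi$ of $V$ satisfying $\pi(b_1)=b_2$. (5) Constant functions: the constant functions belong to $V$. If $N$ is an integer multiple of $c_1$ satisfying $$\min(N,|B|-N)\ge C\cdot c_2c_3^2\dim(V)^6\log(2c_3\dim(V))^6,$$ then there exists a subset $T\subset B$ of size $|T|=N$ satisfying $$\frac{1}{|T|}\sum_{t\in T}f(t)=\frac{1}{|B|}\sum_{b\in B}f(b)\quad\text{for all } f\in V.$$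
   Context: Divisibility constant: the set of all integers $N$ for which there exists $\gamma\in\mathbb{Z}^B$ with $\sum_{b\in B}\gamma_bf(b)=\frac{N}{|B|}\sum_{b\in B}f(b)$ for all $f\in V$ consists of all integer multiples of some minimal positive integer; this integer is the divisibility constant of $V$. Bounded integer basis: for a subspace $W\subset\mathbb{Q}^B$ and $1\le p\le\infty$, $W$ has a $c$-bounded integer basis in $\ell_p$ if $W$ is spanned (over $\mathbb{Q}$) by integer vectors of $\ell_p$ norm at most $c$, i.e. $\mathrm{Span}(\{\gamma\in W\cap\mathbb{Z}^B:\ \|\gamma\|_p\le c\})=W$. Here $\|\gamma\|_1=\sum_{b}|\gamma_b|$ and $\|\gamma\|_\infty=\max_b|\gamma_b|$. Orthogonal complement: $V^\perp:=\{g\in\mathbb{Q}^B:\ \sum_{b\in B}f(b)g(b)=0\ \ \forall f\in V\}$. Symmetry: a symmetry of $V$ is a permutation $\pi$ of $B$ satisfying $f\circ\pi\in V$ for all $f\in V$. *)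

(* Defs.v *)
From HB Require Import structures.
From mathcomp Require Import all_boot all_fingroup all_algebra.

Set Implicit Arguments.
Unset Strict Implicit.
Unset Printing Implicit Defensive.

Import GRing.Theory Num.Theory.
Local Open Scope ring_scope.

(* rat^o is rat, viewed as a one-dimensional vector space over itself. *)
Notation ratfun B := {ffun B -> rat^o}.

Section Definitions.

Variable B : finType.
Implicit Types (V W : {vspace ratfun B}) (f g : ratfun B) (gamma : {ffun B -> int}).

Definition solves_divisibility V (N : int) : Prop :=
  exists gamma, forall f, f \in V ->
    \sum_b (gamma b)%:~R * (f b : rat) =
      (N%:~R / #|B|%:R) * \sum_b (f b : rat).

Definition is_divisibility_constant V (c : nat) : Prop :=
  (0 < c)%N /\ forall N : int, solves_divisibility V N <-> (c%:Z %| N)%Z.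

Definition l1_norm gamma : nat := (\sum_b `|gamma b|)%N.
Definition linfty_norm gamma : nat := (\max_b `|gamma b|)%N.

Definition int_to_rat_vec gamma : ratfun B := [ffun b => (gamma b)%:~R : rat^o].

(* Every spanning set of a finite-dimensional space contains a finite one, so
   it suffices to consider finite families s. *)
Definition has_bounded_integer_basis (norm : {ffun B -> int} -> nat) (c : nat)
    W : Prop :=
  exists2 s : seq {ffun B -> int},
    (forall gamma, gamma \in s ->
       int_to_rat_vec gamma \in W /\ (norm gamma <= c)%N)
    & <<map int_to_rat_vec s>>%VS = W.

Definition dotQ f g : rat^o := \sum_b f b * g b.

Fact dotQ_is_linear f : linear (dotQ f).
Proof.
move=> a g h; rewrite /dotQ scaler_sumr -big_split /=.
by apply: eq_bigr => b _; rewrite !ffunE mulrDr mulrCA.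
Qed.

HB.instance Definition _ f :=
  GRing.isLinear.Build rat (ratfun B) rat^o *:%R (dotQ f) (dotQ_is_linear f).

(* Orthogonality to a basis of V; ortho_complP gives the usual description. *)
Definition ortho_compl V : {vspace ratfun B} :=
  (\bigcap_(i < \dim V) lker (linfun (dotQ (vbasis V)`_i)))%VS.

Lemma ortho_complP V g :
  g \in ortho_compl V <-> (forall f, f \in V -> \sum_b f b * g b = 0).
Proof.
rewrite memvE; split=> [/subv_bigcapP orth f fV | orth].
  rewrite (coord_vbasis fV).
  under eq_bigr => b _ do rewrite sum_ffunE mulr_suml.
  rewrite exchange_big big1 //= => i _.
  have := orth i isT; rewrite -memvE memv_ker lfunE /= => /eqP dot0.
  transitivity (coord (vbasis V) i f * dotQ (vbasis V)`_i g).
    by rewrite mulr_sumr; apply: eq_bigr => b _; rewrite ffunE -mulrA.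
  by rewrite dot0 mulr0.
apply/subv_bigcapP => i _; rewrite -memvE memv_ker lfunE /=; apply/eqP.
by apply: orth; apply: vbasis_mem; rewrite mem_nth ?size_tuple.
Qed.

Definition is_symmetry V (pi : {perm B}) : Prop :=
  forall f, f \in V -> [ffun b => f (pi b)] \in V.

End Definitions.

(* Main.v *)
Require Import Defs.
From mathcomp Require Import all_boot all_fingroup all_order all_algebra.
From mathcomp Require Import reals exp.
From mathcomp Require Import complex boolp topology normedtype sequences derive.
From mathcomp Require Import trigo.
From mathcomp Require Import zify ring lra.

(** The sets sought are found by a local limit theorem.  Write [d] for the
    dimension of [V] and [p = N / #|B|], include each point of [B] in a random
    set [T] independently with probability [p], and let [gamma] be an integral
    vector provided by divisibility, so that [gamma] and the constant [p] have
    the same pairing with every function of [V].  A set [T] is as required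
    exactly when its indicator vector minus [gamma] is orthogonal to [V].  As
    these vectors are integral, the probability of this event is the average
    over a finite grid of frequencies [theta] in [V] of the characteristic
    function [balanced_char] ([sum_balanced_char_eq0]), and it is enough to show
    that the average has positive real part.

    The characteristic function is a product over [B] of characteristic
    functions of Bernoulli variables.  It does not change when an integral
    vector of [V] is added to [theta] ([balanced_char_shift]).  Let [r] be the
    difference of [theta] and its coordinatewise rounding, and weight the sum of
    the [r b ^+ 2] by the variance [p * (1 - p)].  There are three regimes
    ([Re_balanced_char_ge], [Re_balanced_char_box]).
    - If the weighted sum is at least [rho], of the order of [d] times a
      logarithm, the function is exponentially small.
    - If it is less than [rho], the rounding itself lies in [V], so that [theta]
      may be replaced by [r].  As the variables are centered, the phase of the
      product is of third order in [r].  It is small, so the real part is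
      nonnegative.
    - In a box around the origin the real part is at least one third, and the
      proportion of this box in the grid exceeds the exponentially small bound
      above.

    The middle regime carries the arithmetic.  It relies on a set [D] of about
    [d * ln (c2 * d)] points whose evaluations generate the evaluations at all
    points of [B] with coefficients in {-1, 0, 1}; a maximal set with distinct
    subset sums has this property ([unit_coordinates]).  Averaging over the
    transitive group of symmetries yields a translate of [D] on which [r] is at
    most average ([symmetry_average]).  On it the short relations which span the
    orthogonal complement of [V] hold for the rounding up to an error less than
    one, thus exactly, and the values on [D] then determine an integral vector
    of [V] which can only be the rounding ([rounding_in_space]).  The same
    expression of all values through those on [D] bounds [r] uniformly by its
    mean, as the estimate of the phase requires.

    It remains to compare powers and logarithms ([polylog_absorbed]): the
    argument needs [N] and [#|B| - N] to exceed a constant times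
    [c3 ^+ 2 * d ^+ 5 * E ^+ 5], where [E] is the logarithm of the number of
    boxes along each axis of the grid. *)

Import Order.TTheory GRing.Theory Num.Theory numFieldNormedType.Exports.
Local Open Scope ring_scope.
Local Open Scope complex_scope.
Set Implicit Arguments.
Unset Strict Implicit.
Unset Printing Implicit Defensive.

(** * Orthogonal complements and averages over symmetries *)

Lemma dotQC (B : finType) (f g : ratfun B) : dotQ f g = dotQ g f.
Proof. by apply: eq_bigr => b _; rewrite mulrC. Qed.

Lemma dotQ_eq0 (B : finType) (f : ratfun B) : dotQ f f = 0 -> f = 0.
Proof.
move=> f0; apply/ffunP => b; rewrite ffunE; apply/eqP.
have /psumr_eq0P/(_ f0 b isT)/eqP : forall b, true -> 0 <= (f b : rat) * f b.
  by move=> ? _; rewrite -expr2 sqr_ge0.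
by rewrite mulf_eq0 orbb.
Qed.

Lemma dotQ_span0 (B : finType) (X : seq (ratfun B)) (w : ratfun B) :
  (forall x, x \in X -> dotQ x w = 0) ->
  forall f, f \in <<X>>%VS -> dotQ f w = 0.
Proof.
move=> Xw f fX.
have : (<<X>> <= lker (linfun (dotQ w)))%VS.
  by apply/span_subvP => x /Xw xw; rewrite memv_ker lfunE /= dotQC xw.
by move/subvP/(_ f fX); rewrite memv_ker lfunE /= dotQC => /eqP.
Qed.

(** Gram-Schmidt, one generator at a time: the part of a new generator that is
    orthogonal to the previous ones is either zero or gives one more direction
    along which to correct the projection. *)
Lemma ortho_proj (B : finType) (X : seq (ratfun B)) (g : ratfun B) :
  exists2 v, v \in <<X>>%VS & forall x, x \in X -> dotQ x (g - v) = 0.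
Proof.
elim: X g => [|y X IH] g; first by exists 0; rewrite ?mem0v.
have [v vX gv] := IH g; have [u uX yu] := IH y.
have sXyX : {subset <<X>>%VS <= <<y :: X>>%VS}.
  by apply/subvP; rewrite span_cons addvSr.
have z_perp : dotQ (y - u) u = 0 by rewrite dotQC; apply: dotQ_span0 uX.
have dot_y : dotQ y (y - u) = dotQ (y - u) (y - u).
  by rewrite [RHS]linearB /= z_perp subr0 dotQC.
have [z0|z_neq0] := eqVneq (dotQ (y - u) (y - u)) 0.
  move/dotQ_eq0/eqP: z0; rewrite subr_eq0 => /eqP yE.
  exists v; first exact: sXyX.
  move=> x; rewrite inE => /predU1P[->|]; last exact: gv.
  by rewrite yE; apply: dotQ_span0 uX.
exists (v + (dotQ y (g - v) / dotQ (y - u) (y - u)) *: (y - u)).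
  rewrite memvD ?memvZ ?memvB //; try exact: sXyX.
  by rewrite memv_span ?inE ?eqxx.
move=> x; rewrite opprD addrA linearB linearZ /= inE => /predU1P[->|xX].
  by rewrite dot_y; apply/eqP; rewrite subr_eq0; apply/eqP; symmetry; exact: divfK.
by rewrite (gv x xX) (yu x xX) scaler0 subr0.
Qed.

(** The form is positive definite, and the component of [g] orthogonal to [V] is
    orthogonal to itself. *)
Lemma ortho_complK (B : finType) (V : {vspace ratfun B}) (g : ratfun B) :
  (forall h, h \in ortho_compl V -> dotQ h g = 0) -> g \in V.
Proof.
move=> gperp; have [v] := ortho_proj (vbasis V) g.
rewrite (span_basis (vbasisP V)) => vV orth.
have wV : forall f, f \in V -> dotQ f (g - v) = 0.
  by move=> f fV; apply: (dotQ_span0 orth); rewrite (span_basis (vbasisP V)).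
have wperp : g - v \in ortho_compl V by apply/ortho_complP => f /wV.
suff /eqP : g - v = 0 by rewrite subr_eq0 => /eqP ->.
by apply: dotQ_eq0; rewrite linearB /= gperp // dotQC wV // subr0.
Qed.

Lemma symmetry_comp (B : finType) (V : {vspace ratfun B}) (s t : {perm B}) :
  is_symmetry V s -> is_symmetry V t -> is_symmetry V (s * t)%g.
Proof.
move=> sV tV f fV.
have -> : [ffun b => f ((s * t)%g b)] =
          [ffun b => [ffun b' => f (t b')] (s b)] :> ratfun B.
  by apply/ffunP => b; rewrite !ffunE permM.
exact/sV/tV.
Qed.

Lemma symmetry_group_set (B : finType) (V : {vspace ratfun B}) :
  group_set [set s : {perm B} | `[< is_symmetry V s >]].
Proof.
apply/group_setP; split=> [|s t].
  rewrite inE; apply/asboolP => f fV.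
  have -> // : [ffun b => f ((1%g : {perm B}) b)] = f.
  by apply/ffunP => b; rewrite ffunE perm1.
by rewrite !inE => /asboolP sV /asboolP tV; apply/asboolP/symmetry_comp.
Qed.

Lemma symmetry_inv (B : finType) (V : {vspace ratfun B}) (s : {perm B}) :
  is_symmetry V s -> is_symmetry V s^-1%g.
Proof.
move=> sV; have := @groupVr _ (Group (symmetry_group_set V)) s.
by rewrite !inE => /(_ (introT (asboolP _) sV)) /asboolP.
Qed.

(** The symmetries form a transitive group, so the images of a fixed point under
    a uniformly chosen symmetry are equidistributed over [B].  The sum of [h]
    over the image of [D] is thus on average [#|D|] times the mean of [h], and
    some symmetry does no worse than the average. *)
Lemma symmetry_average (B : finType) (V : {vspace ratfun B}) (D : {set B})
    (h : B -> rat) :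
  (forall b1 b2 : B, exists2 s : {perm B}, is_symmetry V s & s b1 = b2) ->
  exists2 s : {perm B}, is_symmetry V s &
    #|B|%:R * \sum_(j in D) h (s j) <= #|D|%:R * \sum_b h b.
Proof.
move=> trV; set G := Group (symmetry_group_set V).
have GP s : reflect (is_symmetry V s) (s \in G) by rewrite inE; apply: asboolP.
pose S j := \sum_(s in G) h (s j).
have S_const i j : S i = S j.
  have [t tV <-] := trV j i.
  rewrite /S [RHS](reindex_inj (mulgI t)) /=.
  apply: eq_big => [s|s _]; last by rewrite permM.
  by rewrite -[RHS]/((t * s)%g \in G) (groupMl s (introT (GP t) tV)).
have S_sum j : #|B|%:R * S j = #|G|%:R * \sum_b h b.
  rewrite mulr_natl -sumr_const.
  rewrite [LHS](_ : _ = \sum_b S b); last by apply: eq_bigr => b _.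
  rewrite exchange_big /= mulr_natl -sumr_const.
  by apply: eq_bigr => s _; rewrite [RHS](reindex_inj (@perm_inj _ s)).
case: (boolP [exists s in G,
    #|B|%:R * \sum_(j in D) h (s j) <= #|D|%:R * \sum_b h b]).
  by case/exists_inP => s /GP sV le_s; exists s.
rewrite negb_exists_in => /forall_inP too_big; exfalso.
have : \sum_(s in G) (#|D|%:R * \sum_b h b) <
       \sum_(s in G) (#|B|%:R * \sum_(j in D) h (s j)).
  apply: ltr_sum => [|s sG]; last by rewrite ltNge too_big.
  by apply/hasP; exists 1%g; [exact: mem_index_enum | exact: (group1 G)].
have -> : \sum_(s in G) (#|B|%:R * \sum_(j in D) h (s j)) =
          \sum_(j in D) (#|B|%:R * S j).
  by rewrite -!mulr_sumr exchange_big.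
under [X in _ < X]eq_bigr => j _ do rewrite S_sum.
by rewrite !sumr_const !mulr_natl -!mulrnA mulnC ltxx.
Qed.

(** * Unit coordinates on a small set of points *)

Lemma free_subfamily (T : eqType) (K : fieldType) (vT : vectType K)
    (g : T -> vT) (s : seq T) :
  exists2 s' : seq T, {subset s' <= s} &
    free (map g s') /\ <<map g s'>>%VS = <<map g s>>%VS.
Proof.
elim: s => [|x s [s' ss' [fs' E]]]; first by exists [::]; rewrite ?nil_free.
case: (boolP (g x \in <<map g s'>>%VS)) => gx.
  exists s'; first by move=> y /ss'; rewrite inE orbC => ->.
  split=> //=; rewrite span_cons -E.
  by apply/esym/addv_idPr; rewrite -memvE.
exists (x :: s').
  by move=> y; rewrite !inE => /predU1P[->|/ss' ->]; rewrite ?eqxx ?orbT.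
by rewrite /= free_cons gx fs' !span_cons E.
Qed.

(** The last clause expresses that the [F i] span [V] in the form in which it is
    used: orthogonality to [V] can be tested on them. *)
Lemma bounded_integer_basis (B : finType) (V : {vspace ratfun B}) (c : nat) :
  has_bounded_integer_basis (@linfty_norm B) c V ->
  exists F : 'I_(\dim V) -> {ffun B -> int},
    [/\ forall i b, (`|F i b| <= c)%N,
        forall i, int_to_rat_vec (F i) \in V &
        forall w, (forall i, dotQ (int_to_rat_vec (F i)) w = 0) ->
          forall f, f \in V -> dotQ f w = 0].
Proof.
case=> s sV defV; have [s' ss' [free_s']] := free_subfamily (@int_to_rat_vec B) s.
rewrite defV => defV'.
have size_s' : size s' = \dim V.
  by move: free_s'; rewrite /free defV' size_map => /eqP.
have s'_nth (i : 'I_(\dim V)) : s'`_i \in s' by rewrite mem_nth ?size_s'.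
exists (fun i => s'`_i); split=> [i b|i|w w0 f].
- have [_ le_c] := sV _ (ss' _ (s'_nth i)).
  apply: leq_trans le_c; exact: (leq_bigmax b).
- by have [] := sV _ (ss' _ (s'_nth i)).
- rewrite -defV'; apply: dotQ_span0 => _ /mapP[g gs' ->].
  have lt_g : (index g s' < \dim V)%N by rewrite -size_s' index_mem.
  by have := w0 (Ordinal lt_g); rewrite /= nth_index.
Qed.

(** Evaluations at the points of a small set [D] generate all evaluations with
    coefficients in {-1, 0, 1}.  Take [D] maximal among the sets whose subset
    sums of evaluations are pairwise distinct.  If [b] is outside [D], two
    subsets of [b |: D] have the same sum; [b] lies in just one of them, and
    solving for it gives the coefficients.  The size of [D] is bounded by the
    pigeonhole principle: its [2 ^ #|D|] subset sums, evaluated on a bounded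
    integer basis of [V], are distinct integer vectors in a box. *)
Lemma unit_coordinates (B : finType) (V : {vspace ratfun B}) (c : nat) :
  has_bounded_integer_basis (@linfty_norm B) c V ->
  exists (D : {set B}) (a : B -> B -> int),
    [/\ forall b j, (`|a b j| <= 1)%N,
        forall f, f \in V -> forall b,
          f b = \sum_(j in D) (a b j)%:~R * f j :> rat &
        (2 ^ #|D| <= (2 * c * #|D|).+1 ^ \dim V)%N].
Proof.
move=> /bounded_integer_basis [F [leF FV F_gen]].
pose same (S S' : {set B}) :=
  forall f, f \in V -> \sum_(j in S) (f j : rat) = \sum_(j in S') (f j : rat).
pose dissoc (D : {set B}) := `[< forall S S' : {set B},
  S \subset D -> S' \subset D -> same S S' -> S = S' >].
have [D /maxsetP[/asboolP D_diss D_max]] : {D | maxset dissoc D}.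
  apply: ex_maxset; exists set0; apply/asboolP => S S'.
  by rewrite !subset0 => /eqP-> /eqP->.
have relation b : exists a : B -> int, (forall j, (`|a j| <= 1)%N) /\
    forall f, f \in V -> f b = \sum_(j in D) (a j)%:~R * f j :> rat.
  have [bD|bD] := boolP (b \in D).
    exists (fun j => (j == b)%:Z); split=> [j|f fV]; first by case: eqP.
    rewrite (bigD1 b) //= eqxx mul1r big1 ?addr0 // => j /andP[_ /negPf->].
    by rewrite mul0r.
  have [S [S' [sS sS' sameSS' neqSS']]] : exists S S' : {set B},
      [/\ S \subset b |: D, S' \subset b |: D, same S S' & S != S'].
    apply: contrapT => no_pair.
    have : dissoc (b |: D).
      apply/asboolP => S S' sS sS' sSS'; apply: contrapT => /eqP nSS'.
      by apply: no_pair; exists S, S'.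
    by move/D_max => /(_ (subsetUr _ _)) E; rewrite -E setU11 in bD.
  have diff_b : (b \in S) != (b \in S').
    apply: contraNneq neqSS' => bSS'; apply/eqP.
    have sub_D (X : {set B}) : X \subset b |: D -> X :\ b \subset D.
      by rewrite subDset.
    have same_b (X : {set B}) : (b \in X) = (b \in S) ->
        forall f, \sum_(j in X) (f j : rat) =
                  (if b \in S then f b : rat else 0) + \sum_(j in X :\ b) f j.
      move=> <- f; case: ifP => bX; first by rewrite (big_setD1 b).
      by rewrite add0r; apply: eq_bigl => j; rewrite !inE; case: eqP => // ->.
    have := D_diss _ _ (sub_D _ sS) (sub_D _ sS').
    move=> /(_ _) eqD; have {eqD} : S :\ b = S' :\ b.
      apply: eqD => f fV; have := sameSS' f fV.
      by rewrite (same_b S) // (same_b S') // => /addrI.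
    move/setP=> eqD; apply/setP=> j; have := eqD j; rewrite !inE.
    by case: eqP => // ->.
  wlog bS : S S' sS sS' sameSS' {neqSS'} diff_b / (b \in S) && (b \notin S').
    move=> IH; case bS: (b \in S) diff_b => bS'.
      by apply: (IH S S'); rewrite ?bS //; case: (b \in S') bS'.
    apply: (IH S' S) => //; last by rewrite bS; case: (b \in S') bS'.
    - by move=> f fV; rewrite sameSS'.
    - by rewrite eq_sym bS.
  have {bS}[bS bS'] := andP bS.
  exists (fun j => (j \in S')%:Z - (j \in S)%:Z); split=> [j|f fV].
    by do 2!case: (_ \in _).
  have := sameSS' f fV; rewrite (big_setD1 b) //= => /eqP.
  rewrite -subr_eq0 -addrA addr_eq0 => /eqP ->; rewrite opprB.
  have restrict (X : {set B}) : X \subset D ->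
      \sum_(j in X) (f j : rat) = \sum_(j in D) (j \in X)%:R * f j :> rat.
    move=> XD; rewrite [RHS](big_setID X) /= (setIidPr XD).
    rewrite [X in _ = _ + X]big1 ?addr0.
      by apply: eq_bigr => j ->; rewrite mul1r.
    by move=> j; rewrite !inE => /andP[/negPf-> _]; rewrite mul0r.
  rewrite !restrict; first last.
  - by apply/subsetP => j jS'; have := subsetP sS' j jS'; rewrite !inE;
      case/predU1P => // jb; rewrite -jb jS' in bS'.
  - by rewrite subDset.
  rewrite -sumrB; apply: eq_bigr => j jD; rewrite -mulrBl rmorphB /=.
  by rewrite !inE; case: eqP => // jb; rewrite -jb jD in bD.
have {relation}[a aP] := choice relation.
exists D, a; split=> [b j|f fV b|]; first by case: (aP b).
  by case: (aP b) => _; apply.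
pose m := (2 * c * #|D|)%N.
pose code (S : {set B}) : {ffun 'I_(\dim V) -> 'I_m.+1} :=
  [ffun i => inord `|(\sum_(j in S) F i j + (c * #|D|)%:Z)%R|%N].
have code_inj : {in powerset D &, injective code}.
  move=> S S'; rewrite !powersetE => sS sS' eq_code.
  apply: D_diss => // f fV; apply/eqP; rewrite -subr_eq0; apply/eqP.
  have sum_le (X : {set B}) i : X \subset D ->
      `|\sum_(j in X) F i j| <= (c * #|D|)%:Z.
    move=> XD; apply: le_trans (ler_norm_sum _ _ _) _.
    apply: (@le_trans _ _ (\sum_(j in X) c%:Z)).
      by apply: ler_sum => j _; have := leF i j; lia.
    rewrite sumr_const -mulr_natr natz -PoszM lez_nat leq_mul2l.
    by rewrite subset_leq_card ?orbT.
  have F_same i : \sum_(j in S) F i j = \sum_(j in S') F i j.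
    move/ffunP/(_ i)/(congr1 val): eq_code; rewrite !ffunE /= !inordK.
    - move: (sum_le S i sS) (sum_le S' i sS').
      move: (\sum_(j in S) F i j) (\sum_(j in S') F i j) (c * #|D|)%N => x y k; lia.
    - move: (sum_le S' i sS'); rewrite /m -mulnA.
      move: (\sum_(j in S') F i j) (c * #|D|)%N => x k; lia.
    - move: (sum_le S i sS); rewrite /m -mulnA.
      move: (\sum_(j in S) F i j) (c * #|D|)%N => x k; lia.
  pose w : ratfun B := [ffun j => (j \in S)%:R - (j \in S')%:R : rat^o].
  have dot_w g : dotQ g w = \sum_(j in S) (g j : rat) - \sum_(j in S') (g j : rat).
    rewrite [X in X - _]big_mkcond [X in _ - X]big_mkcond -sumrB /dotQ.
    apply: eq_bigr => j _; rewrite ffunE mulrBr.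
    by do 2!case: (_ \in _); rewrite ?mulr1 ?mulr0.
  rewrite -dot_w; apply: F_gen fV => i; rewrite dot_w.
  have vecE (X : {set B}) : \sum_(j in X) (int_to_rat_vec (F i) j : rat) =
      (\sum_(j in X) F i j)%:~R.
    by rewrite rmorph_sum; apply: eq_bigr => j _; rewrite ffunE.
  by rewrite !vecE F_same subrr.
rewrite -card_powerset -(card_in_imset code_inj).
by apply: leq_trans (max_card _) _; rewrite card_ffun !card_ord.
Qed.

(** * Rounding *)

Lemma int_eq0_of_lt1 (R : realDomainType) (z : int) : `|z%:~R : R| < 1 -> z = 0.
Proof.
by rewrite -intr_norm ltrz1; lia.
Qed.

(** Move [D] by a symmetry [s] such that the error on [s D] is at most average,
    and let [lam] be the integral combination of the values of [n] on [s D]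
    which reconstructs functions of [V] from those values.  A relation [eta] of
    norm at most [c] becomes a relation [zeta] between the points of [s D] with
    coefficients at most [c]; it annihilates [theta], so its value on [n] is an
    integer of absolute value less than one.  Therefore [lam] satisfies
    all relations and lies in [V].  It differs from [theta] by less than one
    half, which forces [lam = n], and then the error
    everywhere is a combination of the errors on [s D]. *)
Lemma rounding_in_space (B : finType) (V : {vspace ratfun B}) (c : nat)
    (D : {set B}) (a : B -> B -> int) (theta : ratfun B) (n : B -> int) :
  has_bounded_integer_basis (@l1_norm B) c (ortho_compl V) ->
  (forall b1 b2 : B, exists2 s : {perm B}, is_symmetry V s & s b1 = b2) ->
  (forall b j, (`|a b j| <= 1)%N) ->
  (forall f, f \in V -> forall b, f b = \sum_(j in D) (a b j)%:~R * f j :> rat) ->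
  (0 < c)%N -> theta \in V ->
  (forall b, `|(theta b : rat) - (n b)%:~R| <= 2^-1) ->
  2 * c%:R * (#|D|%:R * \sum_b `|(theta b : rat) - (n b)%:~R|) < #|B|%:R ->
  ([ffun b => (n b)%:~R : rat^o] : ratfun B) \in V /\
  forall b, #|B|%:R * `|(theta b : rat) - (n b)%:~R| <=
    #|D|%:R * \sum_b' `|(theta b' : rat) - (n b')%:~R|.
Proof.
move=> [eta etaP eta_span] trV a_le1 aV c_gt0 thetaV r_half small.
pose r b : rat := (theta b : rat) - (n b)%:~R.
have [s sV delta_avg] := symmetry_average D (fun b => `|r b|) trV.
set delta := \sum_(j in D) `|r (s j)| in delta_avg.
have [b0|B0] := pickP (mem B); last first.
  have V_full : forall f : ratfun B, f = 0.
    by move=> f; apply/ffunP => b; have := B0 b.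
  by split=> [|b]; [rewrite [X in X \in _]V_full mem0v | have := B0 b].
have B_gt0 : 0 < #|B|%:R :> rat by rewrite ltr0n; apply/card_gt0P; exists b0.
have c_ge1 : 1 <= c%:R :> rat by rewrite ler1n.
have delta_ge0 : 0 <= delta by apply: sumr_ge0.
have c_delta : 2 * c%:R * delta < 1.
  rewrite -(ltr_pM2l B_gt0) mulr1; apply: le_lt_trans small.
  rewrite mulrCA; apply: ler_wpM2l => //; lra.
have delta_half : delta < 2^-1 by nra.
have coord f : f \in V ->
    forall b, f (s b) = \sum_(j in D) (a b j)%:~R * f (s j) :> rat.
  move=> fV b; have := aV _ (sV f fV) b; rewrite ffunE => ->.
  by apply: eq_bigr => j _; rewrite ffunE.
pose lam b : int := \sum_(j in D) a b j * n (s j).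
have lamE b : (lam b)%:~R =
    (theta (s b) : rat) - \sum_(j in D) (a b j)%:~R * r (s j).
  rewrite (coord _ thetaV) -sumrB rmorph_sum; apply: eq_bigr => j _.
  by rewrite /r rmorphM /=; ring.
have sum_le (w : B -> int) k : (forall j, (`|w j| <= k)%N) ->
    `|\sum_(j in D) (w j)%:~R * r (s j)| <= k%:R * delta.
  move=> w_le; apply: le_trans (ler_norm_sum _ _ _) _; rewrite mulr_sumr.
  apply: ler_sum => j _; rewrite normrM ler_wpM2r //.
  by rewrite -intr_norm -[k%:R]/(k%:Z%:~R) ler_int; have := w_le j; lia.
have lamV : ([ffun b => (lam b)%:~R : rat^o] : ratfun B) \in V.
  apply: ortho_complK => h; rewrite -eta_span => h_eta.
  apply: dotQ_span0 h_eta => _ /mapP[e eS ->].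
  have [/ortho_complP e_perp e_le] := etaP e eS.
  pose zeta j := \sum_b e b * a b j.
  have zeta_le j : (`|zeta j| <= c)%N.
    rewrite -lez_nat abszE; apply: le_trans (ler_norm_sum _ _ _) _.
    apply: (@le_trans _ _ ((\sum_b `|e b|)%N)%:Z).
      rewrite -natz natr_sum; apply: ler_sum => b _.
      by rewrite natz; have := a_le1 b j; nia.
    by rewrite lez_nat.
  have dotE (f : ratfun B) (g : B -> rat) :
      (forall b, f b = \sum_(j in D) (a b j)%:~R * g j :> rat) ->
      dotQ (int_to_rat_vec e) f = \sum_(j in D) (zeta j)%:~R * g j.
    move=> fE; rewrite /dotQ; under eq_bigr => b _ do rewrite fE mulr_sumr.
    rewrite exchange_big; apply: eq_bigr => j _.
    rewrite rmorph_sum mulr_suml; apply: eq_bigr => b _.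
    by rewrite ffunE rmorphM /= mulrA.
  have dot_theta : \sum_(j in D) (zeta j)%:~R * (theta (s j) : rat) = 0.
    rewrite -(dotE [ffun b => theta (s b)] (fun j => theta (s j))) => [|b].
      by rewrite dotQC; apply: e_perp; apply: sV.
    by rewrite ffunE coord.
  have dot_lam : dotQ (int_to_rat_vec e) [ffun b => (lam b)%:~R : rat^o] =
      (\sum_(j in D) zeta j * n (s j))%:~R.
    rewrite (dotE _ (fun j => (n (s j))%:~R)) => [|b].
      by rewrite rmorph_sum; apply: eq_bigr => j _; rewrite rmorphM.
    by rewrite ffunE rmorph_sum; apply: eq_bigr => j _; rewrite rmorphM.
  rewrite dot_lam; set z := \sum_(j in D) _.
  have zE : z%:~R = - \sum_(j in D) (zeta j)%:~R * r (s j) :> rat.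
    apply/eqP; rewrite -addr_eq0; apply/eqP; rewrite -[RHS]dot_theta.
    rewrite /z [X in X + _]rmorph_sum -big_split /=.
    by apply: eq_bigr => j _; rewrite /r rmorphM /=; ring.
  rewrite (_ : z = 0) //; apply: (@int_eq0_of_lt1 rat).
  by rewrite zE normrN; apply: le_lt_trans (sum_le _ _ zeta_le) _; nra.
have n_lam b : n (s b) = lam b.
  apply/eqP; rewrite -subr_eq0; apply/eqP; apply: (@int_eq0_of_lt1 rat).
  have -> : (n (s b) - lam b)%:~R = \sum_(j in D) (a b j)%:~R * r (s j) - r (s b).
    by rewrite rmorphB /= lamE /r; ring.
  apply: le_lt_trans (ler_normB _ _) _.
  by have := sum_le _ 1%N (a_le1 b); have := r_half (s b); rewrite -/(r _); lra.
have r_le b : `|r (s b)| <= delta.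
  have -> : r (s b) = \sum_(j in D) (a b j)%:~R * r (s j).
    by rewrite {1}/r n_lam lamE; ring.
  by have := sum_le _ 1%N (a_le1 b); rewrite mul1r.
split=> [|b].
  have -> : [ffun b => (n b)%:~R : rat^o] =
      [ffun b => [ffun b' => (lam b')%:~R : rat^o] (s^-1%g b)] :> ratfun B.
    by apply/ffunP => b; rewrite !ffunE -n_lam permKV.
  exact: symmetry_inv sV _ lamV.
rewrite -/(r b) -(permKV s b); apply: le_trans delta_avg.
by rewrite ler_wpM2l // ltW.
Qed.

(** * Trigonometric estimates *)

Lemma sin_le_id (R : realType) (x : R) : 0 <= x -> `|sin x| <= x.
Proof.
move=> x0.
have [|c _] := @MVT_segment R sin cos 0 x x0 (fun y _ => is_derive_sin y).
  by apply: continuous_subspaceT; exact: continuous_sin.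
rewrite sin0 !subr0 => ->; rewrite normrM (ger0_norm x0).
by rewrite ler_piMl // cos_max.
Qed.

(** The half-angle formula reduces this to [`|sin y| <= y]. *)
Lemma cos_ge_quadratic (R : realType) (x : R) : 1 - x ^+ 2 / 2 <= cos x.
Proof.
rewrite -(cos_norm x) -(real_normK (num_real x)).
have x2 : 0 <= `|x| / 2 by rewrite divr_ge0.
rewrite [in leRHS](_ : `|x| = (`|x| / 2) *+ 2); last by field.
rewrite cos_mulr2n cos2sin2.
have := sin_le_id x2; rewrite ler_norml => /andP[].
move: (sin (`|x| / 2)) => s; move: `|x| x2 => y *; nra.
Qed.

(** Mean value theorem, with the quadratic lower bound for the derivative [cos]. *)
Lemma sin_ge_cubic (R : realType) (x : R) : 0 <= x -> x - x ^+ 3 / 2 <= sin x <= x.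
Proof.
move=> x0; apply/andP; split; last first.
  by apply: le_trans (sin_le_id x0); apply: ler_norm.
have [|c] := @MVT_segment R sin cos 0 x x0 (fun y _ => is_derive_sin y).
  by apply: continuous_subspaceT; exact: continuous_sin.
rewrite sin0 !subr0 in_itv /= => /andP[c0 cx] ->.
have := cos_ge_quadratic c; move: (cos c) => s s_ge.
have c2 : c ^+ 2 <= x ^+ 2 by rewrite ler_sqr ?nnegrE.
have : 0 <= (s - 1 + x ^+ 2 / 2) * x by apply: mulr_ge0 => //; lra.
rewrite exprS; lra.
Qed.

Lemma sin_cubic (R : realType) (x : R) : `|sin x - x| <= `|x| ^+ 3 / 2.
Proof.
wlog x0 : x / 0 <= x => [IH|].
  case: (lerP 0 x) => [/IH//|x0].
  by have := IH (- x); rewrite sinN -opprD !normrN => -> //; lra.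
rewrite (ger0_norm x0) ler_norml; have := sin_ge_cubic x0.
by move: (sin x) => s; lra.
Qed.

Lemma pi_le4 (R : realType) : pi <= 4 :> R.
Proof. by have := @pihalf_lt2 R; lra. Qed.

(** A weak form of Jordan's inequality.  Halving the angle twice brings it into
    the range where the Taylor bounds for [sin] and [cos] are effective. *)
Lemma one_sub_cos_ge (R : realType) (r : R) : `|r| <= 2^-1 ->
  r ^+ 2 / 2 <= 1 - cos (2 * pi * r).
Proof.
move=> r_half; rewrite -cos_norm -(real_normK (num_real r)).
rewrite normrM (@ger0_norm _ (2 * pi)) ?mulr_ge0 ?pi_ge0 //.
have [p2 p4] := (@pi_ge2 R, @pi_le4 R).
have r0 := normr_ge0 r.
pose w := pi * `|r| / 2.
have -> : 2 * pi * `|r| = (w *+ 2) *+ 2 by rewrite /w -mulrnA -mulr_natr; field.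
rewrite cos_mulr2n cos2sin2 sin_mulr2n.
have w0 : 0 <= w by rewrite /w; nra.
have w_ge : `|r| <= w by rewrite /w; nra.
have w1 : w <= 1 by rewrite /w; nra.
have s_ge : w / 2 <= sin w.
  have /andP[+ _] := sin_ge_cubic w0; apply: le_trans; rewrite exprS; nra.
have c_ge : 1 / 2 <= cos w by apply: le_trans (cos_ge_quadratic w); nra.
have sc_ge : w / 4 <= cos w * sin w by nra.
move: sc_ge; move: (cos w * sin w) => k; rewrite -mulr_natr; nra.
Qed.

(** * Characteristic functions of Bernoulli variables *)

(** The additive character of [R / Z]. *)
Definition turn (R : realType) (t : R) : R[i] :=
  cos (2 * pi * t) +i* sin (2 * pi * t).

Lemma turnD (R : realType) (s t : R) : turn (s + t) = turn s * turn t.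
Proof.
rewrite /turn mulrDr cosD sinD; apply/eqP; rewrite eq_complex /= eqxx /=.
by rewrite addrC.
Qed.

Lemma turn0 (R : realType) : turn 0 = 1 :> R[i].
Proof. by rewrite /turn mulr0 cos0 sin0. Qed.

Lemma turn_sum (R : realType) (I : Type) (r : seq I) (P : pred I) (F : I -> R) :
  turn (\sum_(i <- r | P i) F i) = \prod_(i <- r | P i) turn (F i).
Proof. exact: (big_morph _ (@turnD R) (turn0 R)). Qed.

Lemma turn_natmul (R : realType) (t : R) (k : nat) : turn (k%:R * t) = turn t ^+ k.
Proof.
elim: k => [|k IH]; first by rewrite mul0r turn0.
by rewrite -natr1 mulrDl mul1r turnD IH exprSr.
Qed.

Lemma turn1 (R : realType) : turn 1 = 1 :> R[i].
Proof. by rewrite /turn mulr1 mulr_natl cos2pi sin2pi. Qed.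

Lemma turn_int (R : realType) (z : int) : turn (z%:~R : R) = 1.
Proof.
have turn_nat (k : nat) : turn (k%:R : R) = 1.
  by rewrite -[k%:R]mulr1 turn_natmul turn1 expr1n.
case: z => k; first exact: turn_nat.
have := turnD ((Negz k)%:~R : R) k.+1%:R.
by rewrite turn_nat mulr1 NegzE rmorphN addNr turn0 => <-.
Qed.

Lemma turn_neq1 (R : realType) (t : R) : 0 < t < 1 -> turn t != 1.
Proof.
move=> /andP[t0 t1]; rewrite /turn eq_complex /=; apply/nandP; left.
have -> : 2 * pi * t = (pi * t) *+ 2 by rewrite -[RHS]mulr_natl mulrA.
rewrite cos_mulr2n cos2sin2.
have : 0 < sin (pi * t) by apply: sin_gt0_pi; have := @pi_gt0 R; nra.
by move: (sin _) => s s0; apply/eqP; rewrite -mulr_natr; nra.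
Qed.

(** The squared modulus as an element of [R], so that it can be compared
    with real exponentials. *)
Definition sqn (R : realType) (z : R[i]) : R :=
  complex.Re z ^+ 2 + complex.Im z ^+ 2.

Lemma sqnM (R : realType) (y z : R[i]) : sqn (y * z) = sqn y * sqn z.
Proof. by case: y z => [a b] [c d]; rewrite /sqn /=; ring. Qed.

Lemma sqn_prod (R : realType) (I : finType) (F : I -> R[i]) :
  sqn (\prod_i F i) = \prod_i sqn (F i).
Proof.
apply: (big_morph _ (@sqnM R)).
by rewrite /sqn /= expr1n expr0n addr0.
Qed.

Lemma sqn_turn (R : realType) (t : R) : sqn (turn t) = 1.
Proof. exact: cos2Dsin2. Qed.

Lemma sqn_bernoulli (R : realType) (p x t : R) : 
  sqn ((1 - p)%:C * turn x + p%:C * turn (x + t)) =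
  1 - 2 * (p * (1 - p)) * (1 - cos (2 * pi * t)).
Proof.
have -> : (1 - p)%:C * turn x + p%:C * turn (x + t) =
    turn x * ((1 - p)%:C + p%:C * turn t) by rewrite turnD; ring.
rewrite sqnM sqn_turn mul1r /sqn /turn /=.
have := cos2Dsin2 (2 * pi * t).
move: (cos _) (sin _) => c s cs.
by rewrite !mul0r !subr0 !addr0 add0r; nra.
Qed.

(** The characteristic function of a Bernoulli variable decays like a Gaussian
    of the same variance, as long as the frequency is reduced modulo one. *)
Lemma sqn_bernoulli_le (R : realType) (p x t : R) : 0 <= p <= 1 ->
  `|t| <= 2^-1 ->
  sqn ((1 - p)%:C * turn x + p%:C * turn (x + t)) <=
    expR (- (p * (1 - p) * t ^+ 2)).
Proof.
move=> /andP[p0 p1] t_half; rewrite sqn_bernoulli.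
apply: le_trans (expR_ge1Dx _).
have := one_sub_cos_ge t_half; have : 0 <= p * (1 - p) by nra.
by move: (cos _) (p * (1 - p)) => c q; nra.
Qed.

Lemma pi2_le16 (R : realType) : pi ^+ 2 <= 16 :> R.
Proof. by have := @pi_ge2 R; have := @pi_le4 R; nra. Qed.

(** The characteristic function of a Bernoulli variable minus its mean [p]. *)
Definition centered_bernoulli (R : realType) (p t : R) : R[i] :=
  (1 - p)%:C * turn (- (p * t)) + p%:C * turn ((1 - p) * t).

Lemma Re_centered_bernoulli (R : realType) (p t : R) : 0 <= p <= 1 ->
  1 - 32 * (p * (1 - p)) * t ^+ 2 <= complex.Re (centered_bernoulli p t).
Proof.
move=> /andP[p0 p1]; rewrite /= !mul0r !subr0 !mulrN !cosN.
have quad x : 1 - 32 * x ^+ 2 <= cos (2 * pi * x :> R).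
  apply: le_trans (cos_ge_quadratic _); have := @pi2_le16 R.
  by rewrite !exprMn; have := sqr_ge0 x; move: (pi ^+ 2) (x ^+ 2) => a b; nra.
have H1 : (1 - p) * (1 - 32 * (p * t) ^+ 2) <= (1 - p) * cos (2 * pi * (p * t)).
  by rewrite ler_wpM2l ?quad // subr_ge0.
have H2 : p * (1 - 32 * ((1 - p) * t) ^+ 2) <= p * cos (2 * pi * ((1 - p) * t)).
  by rewrite ler_wpM2l ?quad.
by apply: le_trans (lerD H1 H2); rewrite le_eqVlt; apply/orP; left; apply/eqP; ring.
Qed.

(** The variable is centered, so the linear terms of the two sines cancel and
    the imaginary part is of third order. *)
Lemma Im_centered_bernoulli (R : realType) (p t : R) : 0 <= p <= 1 ->
  `|complex.Im (centered_bernoulli p t)| <= 256 * (p * (1 - p)) * `|t| ^+ 3.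
Proof.
move=> /andP[p0 p1]; rewrite /= !mul0r !addr0 !mulrN !sinN.
have cubic x : `|sin (2 * pi * x) - 2 * pi * x| <= 256 * `|x| ^+ 3 :> R.
  apply: le_trans (sin_cubic _) _.
  rewrite !normrM !exprMn (ger0_norm (@pi_ge0 R)) (ger0_norm (ler0n R 2)).
  have pi3 : pi ^+ 3 <= 64 :> R.
    rewrite (_ : 64 = 4 * 16) ?(exprS _ 2); last by ring.
    by apply: ler_pM; rewrite ?sqr_ge0 ?pi_ge0 ?pi_le4 ?pi2_le16.
  have x3 := exprn_ge0 3 (normr_ge0 x).
  have := ler_wpM2r x3 pi3; move: (pi ^+ 3) (`|x| ^+ 3) x3 => a b *; lra.
set sp := sin (2 * pi * (p * t)); set sq := sin (2 * pi * ((1 - p) * t)).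
have -> : (1 - p) * - sp + p * sq =
    p * (sq - 2 * pi * ((1 - p) * t)) - (1 - p) * (sp - 2 * pi * (p * t)) by ring.
apply: le_trans (ler_normB _ _) _.
have p1' : 0 <= 1 - p by rewrite subr_ge0.
rewrite !normrM (ger0_norm p0) (ger0_norm p1').
apply: le_trans (lerD (ler_wpM2l p0 (cubic _)) (ler_wpM2l p1' (cubic _))) _.
rewrite !normrM (ger0_norm p0) (ger0_norm p1').
have b0 : 0 <= `|t| ^+ 3 by rewrite exprn_ge0.
rewrite !exprMn; move: (`|t| ^+ 3) b0 => b b0.
have : 0 <= p * (1 - p) * b * (p * (1 - p)) by rewrite !mulr_ge0.
lra.
Qed.

Lemma prod_one_sub_ge (R : realDomainType) (I : finType) (x : I -> R) :
  (forall i, 0 <= x i <= 1) -> 1 - \sum_i x i <= \prod_i (1 - x i).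
Proof.
move=> x01.
(* the upper bound by 1 is needed to propagate the lower bound *)
suff /andP[] : (\prod_i (1 - x i) <= 1) &&
    (1 - \sum_i x i <= \prod_i (1 - x i)) by [].
elim/big_rec2: _ => [|i s pr _ /andP[pr1 IH]]; first by rewrite subr0 lexx.
have /andP[x0 x1] := x01 i; apply/andP; split; nra.
Qed.

Lemma ReM (R : realType) (x y : R[i]) : complex.Re (x * y) =
  complex.Re x * complex.Re y - complex.Im x * complex.Im y.
Proof. by case: x y => [? ?] [? ?]. Qed.

Lemma ImM (R : realType) (x y : R[i]) : complex.Im (x * y) =
  complex.Re x * complex.Im y + complex.Im x * complex.Re y.
Proof. by case: x y => [? ?] [? ?]. Qed.

(** A product of complex numbers of small argument stays close to the product of
    their real parts.  Dividing by the real parts, the factors become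
    [1 + 'i * alpha] with [`|alpha| <= a i]; the distance from such a product
    to one is at most [\prod_i (1 + a i) - 1 <= expR (\sum_i a i) - 1], which
    is at most one third. *)
Lemma Re_prod_ge (R : realType) (I : finType) (z : I -> R[i]) (a : I -> R) :
  (forall i, 0 <= complex.Re (z i)) -> (forall i, 0 <= a i) ->
  (forall i, `|complex.Im (z i)| <= a i * complex.Re (z i)) ->
  \sum_i a i <= 4^-1 ->
  (\prod_i complex.Re (z i)) / 2 <= complex.Re (\prod_i z i).
Proof.
move=> u0 a0 im_le sum_a.
pose P s := \prod_(i <- s) complex.Re (z i).
pose W s := \prod_(i <- s) (1 + a i) - 1.
have invariant s : [/\ 0 <= P s, 0 <= W s,
    `|complex.Im (\prod_(i <- s) z i)| <= W s * P s &
    `|complex.Re (\prod_(i <- s) z i) - P s| <= W s * P s].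
  rewrite /P /W; elim: s => [|i s].
    by rewrite !big_nil subrr mul0r; split; rewrite /= ?subrr ?normr0.
  rewrite !big_cons.
  set Ps := \prod_(i <- s) complex.Re (z i).
  set Q := \prod_(i <- s) (1 + a i); set Z := \prod_(i <- s) z i.
  case=> P0 W0 im re.
  have {u0}ui := u0 i; have {im_le}vi := im_le i; have {a0}ai := a0 i.
  rewrite ReM ImM; move: im re vi ui.
  move: (complex.Re (z i)) (complex.Im (z i)) (complex.Re Z) (complex.Im Z).
  move=> u v U V im re vi ui.
  have WP0 : 0 <= (Q - 1) * Ps by apply: mulr_ge0.
  have uP0 : 0 <= u * Ps by apply: mulr_ge0.
  have vV : `|v * V| <= a i * u * ((Q - 1) * Ps).
    by rewrite normrM; apply: ler_pM.
  have U_le : `|U| <= Q * Ps.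
    rewrite -[U](subrK Ps); apply: le_trans (ler_normD _ _) _.
    by rewrite (ger0_norm P0); lra.
  have vU : `|v * U| <= a i * u * (Q * Ps) by rewrite normrM; apply: ler_pM.
  have uV : `|u * V| <= u * ((Q - 1) * Ps).
    by rewrite normrM (ger0_norm ui); apply: ler_wpM2l.
  have uU : `|u * (U - Ps)| <= u * ((Q - 1) * Ps).
    by rewrite normrM (ger0_norm ui); apply: ler_wpM2l.
  split=> //.
  - nra.
  - apply: le_trans (ler_normD _ _) _; apply: le_trans (lerD uV vU) _.
    by rewrite le_eqVlt; apply/orP; left; apply/eqP; ring.
  - rewrite (_ : _ - _ = u * (U - Ps) - v * V); last by ring.
    apply: le_trans (ler_normB _ _) _; apply: le_trans (lerD uU vV) _.
    rewrite -subr_ge0 (_ : _ - _ = a i * (u * Ps)); last by ring.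
    exact: mulr_ge0.
have [P0 W0 _] := invariant (index_enum I).
have W_small : W (index_enum I) <= 3^-1.
  have prod_le : \prod_i (1 + a i) <= expR 4^-1.
    apply: (@le_trans _ _ (expR (\sum_i a i))); last by rewrite ler_expR.
    rewrite expR_sum; apply: ler_prod => i _.
    by rewrite expR_ge1Dx andbT addr_ge0.
  have : 1 - 4^-1 <= expR (- 4^-1) :> R by apply: expR_ge1Dx.
  rewrite expRN => e_le; rewrite /W lerBlDr; apply: le_trans prod_le _.
  have e0 : 0 < expR 4^-1 :> R by apply: expR_gt0.
  have : expR 4^-1 * (1 - 4^-1) <= 1 :> R.
    by rewrite -ler_pdivlMl // mulr1.
  lra.
rewrite ler_norml => /andP[+ _]; rewrite -/(P (index_enum I)).
move: (W _) (P _) P0 W_small W0 => w p *; nra.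
Qed.

(** Near the origin the phase of the product is controlled by the third moment of
    the frequencies and its modulus by the second moment. *)
Lemma Re_prod_centered_ge (R : realType) (I : finType) (p : R) (t : I -> R) :
  0 <= p <= 1 -> (forall i, `|t i| <= 4^-1) ->
  2048 * (p * (1 - p)) * (\sum_i `|t i| ^+ 3) <= 1 ->
  0 <= complex.Re (\prod_i centered_bernoulli p (t i)) /\
  (1 - 32 * (p * (1 - p)) * \sum_i t i ^+ 2) / 2 <=
    complex.Re (\prod_i centered_bernoulli p (t i)).
Proof.
move=> p01 t_small cubes; set q := p * (1 - p).
have q0 : 0 <= q by move: p01; rewrite /q => /andP[*]; nra.
have q4 : q <= 4^-1 by have := sqr_ge0 (p - 2^-1); rewrite /q; lra.
have x01 i : 0 <= 32 * q * t i ^+ 2 <= 2^-1.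
  have : t i ^+ 2 <= 16^-1.
    rewrite -(real_normK (num_real (t i))).
    by have := t_small i; have := normr_ge0 (t i); move: `|t i| => y *; nra.
  by have := sqr_ge0 (t i); move: (t i ^+ 2) => x *; apply/andP; split; nra.
have re_ge i := Re_centered_bernoulli (t i) p01.
have re_half i : 2^-1 <= complex.Re (centered_bernoulli p (t i)).
  by apply: le_trans (re_ge i); have /andP[_] := x01 i; rewrite -/q; lra.
have re0 i : 0 <= complex.Re (centered_bernoulli p (t i)).
  by apply: le_trans (re_half i); rewrite invr_ge0.
have prod_ge := @Re_prod_ge R I (fun i => centered_bernoulli p (t i))
  (fun i => 512 * q * `|t i| ^+ 3) re0.
have half_prod : (\prod_i complex.Re (centered_bernoulli p (t i))) / 2 <=
    complex.Re (\prod_i centered_bernoulli p (t i)).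
  apply: prod_ge => [i|i|].
    by apply: mulr_ge0; [apply: mulr_ge0 | apply: exprn_ge0].
    apply: le_trans (Im_centered_bernoulli _ p01) _; rewrite -/q.
    have : 0 <= q * `|t i| ^+ 3 by apply: mulr_ge0 => //; apply: exprn_ge0.
    move=> qt0; have := re_half i; rewrite -subr_ge0 => /(mulr_ge0 qt0).
    by move: (complex.Re _) (`|t i| ^+ 3) => u y; lra.
  by rewrite -mulr_sumr; rewrite -/q in cubes; lra.
split; first by apply: le_trans half_prod; rewrite divr_ge0 ?prodr_ge0.
apply: le_trans half_prod; rewrite ler_pM2r ?invr_gt0 ?ltr0n //.
apply: (@le_trans _ _ (\prod_i (1 - 32 * q * t i ^+ 2))).
  rewrite mulr_sumr; apply: prod_one_sub_ge => i; have /andP[-> /=] := x01 i; lra.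
apply: ler_prod => i _; rewrite re_ge andbT.
by have /andP[_] := x01 i; lra.
Qed.

(** * Fourier inversion on a finite grid *)

Lemma sum_turn_eq0 (R : realType) (M : nat) (k : int) :
  0 < `|k| < M%:Z -> \sum_(y < M) turn (y%:R * (k%:~R / M%:R) : R) = 0.
Proof.
move=> /andP[k0 kM].
have M_gt0 : 0 < M%:R :> R by rewrite ltr0n; lia.
have w_neq1 : turn (k%:~R / M%:R : R) != 1.
  wlog k_gt0 : k k0 kM / 0 < k => [IH|].
    case: (ltrgtP 0 k) => [||k00]; [exact: IH| |by rewrite -k00 in k0].
    move=> k_lt0; have := IH (- k); rewrite normrN oppr_gt0 => /(_ k0 kM k_lt0).
    apply: contraNneq => w1; have := turnD (k%:~R / M%:R : R) ((- k)%:~R / M%:R).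
    by rewrite w1 mul1r => <-; rewrite -mulrDl rmorphN subrr mul0r turn0.
  apply: turn_neq1; rewrite divr_gt0 ?ltr0z //= ltr_pdivrMr // mul1r.
  by rewrite -[M%:R]/(M%:Z%:~R) ltr_int; lia.
under eq_bigr => y _ do rewrite turn_natmul.
have : turn (k%:~R / M%:R : R) ^+ M - 1 = 0.
  by rewrite -turn_natmul mulrC divfK ?gt_eqF // turn_int subrr.
rewrite subrX1 => /eqP; rewrite mulf_eq0 subr_eq0 (negPf w_neq1) /= => /eqP //.
Qed.

(** Choose a random set [T] by including each point independently with
    probability [p].  This is the characteristic function, at the frequency
    [theta], of the indicator vector of [T] translated by [- gamma]. *)
Definition balanced_char (R : realType) (B : finType) (gamma : {ffun B -> int})
    (p : R) (theta : B -> R) : R[i] :=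
  \prod_b ((1 - p)%:C * turn (- (gamma b)%:~R * theta b) +
           p%:C * turn ((1 - (gamma b)%:~R) * theta b)).

Definition grid_point (R : realType) (B : finType) (d M : nat)
    (F : 'I_d -> {ffun B -> int}) (x : {ffun 'I_d -> 'I_M}) (b : B) : R :=
  \sum_i (x i)%:R * ((F i b)%:~R / M%:R).

(** Fourier inversion on the finite group of frequencies [x / M]: averaging over
    it computes the probability that all pairings of the translated indicator
    vector with the [F i] vanish modulo [M].  Expanding the product over [B]
    gives a sum over the sets [T], and for each of them some coordinate
    contributes a vanishing geometric sum. *)
Lemma sum_balanced_char_eq0 (R : realType) (B : finType) (d M : nat)
    (F : 'I_d -> {ffun B -> int}) (gamma : {ffun B -> int}) (p : R) :
  (forall T : {set B}, exists i,
     0 < `|\sum_b ((b \in T)%:Z - gamma b) * F i b| < M%:Z) ->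
  \sum_(x : {ffun 'I_d -> 'I_M}) balanced_char gamma p (grid_point R F x) = 0.
Proof.
move=> no_T.
pose k (T : {set B}) i : int := \sum_b ((b \in T)%:Z - gamma b) * F i b.
have expand (x : {ffun 'I_d -> 'I_M}) :
    balanced_char gamma p (grid_point R F x) = \sum_(T in {set B})
    (\prod_b if b \in T then p%:C else (1 - p)%:C) *
    \prod_i turn ((x i)%:R * ((k T i)%:~R / M%:R)).
  rewrite /balanced_char; under eq_bigr => b _ do rewrite addrC.
  rewrite bigA_distr; apply: eq_bigr => T _.
  rewrite -turn_sum.
  have -> : \sum_i (x i)%:R * ((k T i)%:~R / M%:R) =
      \sum_b ((b \in T)%:R - (gamma b)%:~R) * grid_point R F x b :> R.
    under [RHS]eq_bigr => b _ do rewrite mulr_sumr.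
    rewrite [RHS]exchange_big; apply: eq_bigr => i _.
    rewrite /k rmorph_sum mulr_suml mulr_sumr; apply: eq_bigr => b _.
    by rewrite rmorphM rmorphB /=; ring.
  rewrite turn_sum -big_split; apply: eq_bigr => b _ /=.
  by case: (b \in T); rewrite ?sub0r.
under eq_bigr => x _ do rewrite expand.
rewrite exchange_big big1 // => T _; rewrite -mulr_sumr.
rewrite -(bigA_distr_bigA (fun i (y : 'I_M) => turn (y%:R * ((k T i)%:~R / M%:R)))).
have [i ki] := no_T T.
by rewrite (bigD1 i) //= sum_turn_eq0 // mul0r mulr0.
Qed.

(** * Lower bounds for the characteristic function *)

Lemma sqr_sum_le (R : realFieldType) (I : finType) (x : I -> R) :
  (\sum_i x i) ^+ 2 <= #|I|%:R * \sum_i x i ^+ 2.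
Proof.
set S := \sum_i x i; set n : R := #|I|%:R.
have [n0|n0] := eqVneq #|I| 0%N.
  have e0 (y : I -> R) : \sum_i y i = 0.
    by rewrite big1 // => i; have := card0_eq n0 i.
  by rewrite /S !e0 expr0n mulr0.
have n_gt0 : 0 < n by rewrite ltr0n lt0n.
have : 0 <= \sum_i (n * x i - S) ^+ 2 by apply: sumr_ge0 => i _; apply: sqr_ge0.
have -> : \sum_i (n * x i - S) ^+ 2 = n * (n * (\sum_i x i ^+ 2) - S ^+ 2).
  transitivity (\sum_i (n ^+ 2 * x i ^+ 2 + (- 2 * n * S) * x i + S ^+ 2)).
    by apply: eq_bigr => i _; ring.
  by rewrite !big_split /= -!mulr_sumr sumr_const -mulr_natr -/S -/n; ring.
by rewrite pmulr_rge0 // subr_ge0.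
Qed.

(** Adding an integral vector [n] to [theta] multiplies the function by the
    [turn] of an integer, so [theta] may be replaced by its fractional part, on
    which pairing with [gamma] is the same as multiplying the sum by [p]. *)
Lemma balanced_char_shift (R : realType) (B : finType) (gamma : {ffun B -> int})
    (p : R) (theta : B -> R) (n : B -> int) :
  \sum_b (gamma b)%:~R * (theta b - (n b)%:~R) =
    p * \sum_b (theta b - (n b)%:~R) ->
  balanced_char gamma p theta = \prod_b centered_bernoulli p (theta b - (n b)%:~R).
Proof.
move=> gamma_p.
have turn_shift b : turn (theta b) = turn (theta b - (n b)%:~R).
  by have := turnD (theta b - (n b)%:~R) (n b)%:~R; rewrite subrK turn_int mulr1.
have factor b : (1 - p)%:C * turn (- (gamma b)%:~R * theta b) +
    p%:C * turn ((1 - (gamma b)%:~R) * theta b) =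
    turn (- (gamma b)%:~R * theta b) *
      ((1 - p)%:C + p%:C * turn (theta b - (n b)%:~R)).
  rewrite (_ : (1 - _) * theta b = - (gamma b)%:~R * theta b + theta b);
    last by ring.
  by rewrite (turnD (- _ * _)) (turn_shift b); ring.
have centered b : centered_bernoulli p (theta b - (n b)%:~R) =
    turn (- (p * (theta b - (n b)%:~R))) *
      ((1 - p)%:C + p%:C * turn (theta b - (n b)%:~R)).
  rewrite /centered_bernoulli; set u := theta b - _.
  by rewrite (_ : (1 - p) * u = - (p * u) + u) ?(turnD (- (p * u))); ring.
rewrite /balanced_char (eq_bigr _ (fun b _ => factor b)).
rewrite (eq_bigr _ (fun b _ => centered b)) !big_split /=; congr (_ * _).
rewrite -!turn_sum sumrN -mulr_sumr -gamma_p.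
have -> : \sum_b - (gamma b)%:~R * theta b =
    - (\sum_b (gamma b)%:~R * (theta b - (n b)%:~R)) + (- \sum_b gamma b * n b)%:~R.
  rewrite rmorphN rmorph_sum -!sumrN -big_split; apply: eq_bigr => b _ /=.
  by rewrite rmorphM /=; ring.
by rewrite turnD turn_int mulr1.
Qed.

Lemma sqn_balanced_char_le (R : realType) (B : finType) (gamma : {ffun B -> int})
    (p : R) (theta : B -> R) (n : B -> int) :
  0 <= p <= 1 -> (forall b, `|theta b - (n b)%:~R| <= 2^-1) ->
  sqn (balanced_char gamma p theta) <=
    expR (- (p * (1 - p) * \sum_b (theta b - (n b)%:~R) ^+ 2)).
Proof.
move=> p01 r_half; rewrite sqn_prod mulr_sumr -sumrN expR_sum.
apply: ler_prod => b _; apply/andP; split; first by rewrite addr_ge0 ?sqr_ge0.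
have -> : turn ((1 - (gamma b)%:~R) * theta b) =
    turn (- (gamma b)%:~R * theta b + (theta b - (n b)%:~R)).
  rewrite -[LHS]mulr1 -(turn_int R (- n b)) -turnD; congr turn.
  by rewrite rmorphN /=; ring.
exact: sqn_bernoulli_le.
Qed.

(** Round [theta] and let [q * Q] be the second moment of the rounding error,
    weighted by the variance [q] of a Bernoulli variable.  If it is at least
    [rho], Gaussian decay makes the modulus small.  Otherwise Cauchy-Schwarz
    makes the mean error small, so the rounding lies in [V] and the error
    bounded by [tau]; after shifting by the rounding, the third moment is at
    most [tau * rho], hence the phase is small and the real part is
    nonnegative.  The three conditions on [rho] make, in this order, the
    rounding lie in [V], [tau] at most one quarter, and the phase small. *)
Lemma Re_balanced_char_ge (R : realType) (B : finType) (V : {vspace ratfun B})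
    (c : nat) (D : {set B}) (a : B -> B -> int) (gamma : {ffun B -> int})
    (p : rat) (rho : R) (theta : ratfun B) :
  has_bounded_integer_basis (@l1_norm B) c (ortho_compl V) ->
  (forall b1 b2 : B, exists2 s : {perm B}, is_symmetry V s & s b1 = b2) ->
  (forall b j, (`|a b j| <= 1)%N) ->
  (forall f, f \in V -> forall b, f b = \sum_(j in D) (a b j)%:~R * f j :> rat) ->
  (forall f, f \in V ->
     \sum_b (gamma b)%:~R * (f b : rat) = p * \sum_b (f b : rat)) ->
  (0 < c)%N -> 0 < p < 1 -> theta \in V ->
  let q : R := ratr p * (1 - ratr p) in
  4 * c%:R ^+ 2 * #|D|%:R ^+ 2 * rho < q * #|B|%:R ->
  16 * #|D|%:R ^+ 2 * rho <= q * #|B|%:R ->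
  2048 ^+ 2 * #|D|%:R ^+ 2 * rho ^+ 3 <= q * #|B|%:R ->
  - expR (- (rho / 2)) <=
    complex.Re (balanced_char gamma (ratr p) (fun b => ratr (theta b : rat))).
Proof.
move=> etas trV a_le1 aV gammaV c_gt0 /andP[p0 p1] thetaV q lattice small cubic.
pose n b := Num.floor ((theta b : rat) + 2^-1).
pose r b : rat := (theta b : rat) - (n b)%:~R.
have r_half b : `|r b| <= 2^-1.
  have /andP[] := real_floor_itv (num_real ((theta b : rat) + 2^-1)).
  by rewrite -/(n b) rmorphD /= /r ler_norml => *; apply/andP; split; lra.
have ratr_r b : ratr (theta b : rat) - (n b)%:~R = ratr (r b) :> R.
  by rewrite rmorphB /= ratr_int.
pose Q : R := \sum_b ratr (r b) ^+ 2.
have p01 : 0 < (ratr p : R) < 1 by rewrite ltr0q p0 -(rmorph1 (@ratr R)) ltr_rat.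
have /andP[pR0 pR1] := p01.
have q0 : 0 < q by rewrite mulr_gt0 ?subr_gt0.
have p01' : 0 <= (ratr p : R) <= 1 by rewrite !ltW.
case: (lerP rho (q * Q)) => [far|core].
  have := @sqn_balanced_char_le R B gamma (ratr p)
    (fun b => ratr (theta b : rat)) n p01'.
  move=> /(_ _)/le_trans sqn_le.
  have {}sqn_le : sqn (balanced_char gamma (ratr p) (fun b => ratr (theta b : rat)))
      <= expR (- (rho / 2)) ^+ 2.
    apply: sqn_le => [b|].
      rewrite ratr_r -ratr_norm (_ : 2^-1 = ratr 2^-1) ?ler_rat //.
      by rewrite fmorphV /= ratr_nat.
    rewrite -expRM_natl ler_expR; under eq_bigr => b _ do rewrite ratr_r.
    by rewrite -/q -/Q; lra.
  have e0 := expR_gt0 (- (rho / 2)).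
  move: sqn_le; rewrite /sqn; move: (complex.Re _) (complex.Im _) => u v uv.
  by have := sqr_ge0 v; nra.
pose S : rat := \sum_b `|r b|.
have S2 : (ratr S) ^+ 2 <= #|B|%:R * Q.
  rewrite rmorph_sum; apply: le_trans (sqr_sum_le _) _; rewrite le_eqVlt.
  by apply/orP; left; apply/eqP; congr (_ * _); apply: eq_bigr => b _;
    rewrite /= ratr_norm real_normK ?num_real.
have Q0 : 0 <= Q by apply: sumr_ge0 => b _; apply: sqr_ge0.
have rho_gt0 : 0 < rho by apply: le_lt_trans core; rewrite mulr_ge0 // ltW.
set s : R := #|D|%:R in lattice small cubic *.
set nB : R := #|B|%:R in lattice small cubic S2 *.
have s0 : 0 <= s by rewrite ler0n.
have nB_ge0 : 0 <= nB by rewrite ler0n.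
have S0 : 0 <= ratr S :> R by rewrite ler0q sumr_ge0.
have [SR SRE] : exists SR : R, ratr S = SR by exists (ratr S).
rewrite SRE in S2 S0.
have nB0 : 0 < nB.
  rewrite lt_neqAle nB_ge0 andbT; apply: contraTneq lattice => <-.
  by rewrite mulr0 -leNgt !mulr_ge0 ?exprn_ge0 ?ler0n // ltW.
have qS2 : q * SR ^+ 2 <= nB * rho.
  apply: (@le_trans _ _ (q * (nB * Q))); first by rewrite ler_wpM2l // ltW.
  by rewrite mulrCA ler_wpM2l // ltW.
have close : 2 * c%:R * (#|D|%:R * S) < #|B|%:R.
  rewrite -(ltr_rat R) !rmorphM /= !ratr_nat SRE -/s -/nB ltNge; apply/negP => far.
  have X0 := mulr_ge0 (mulr_ge0 (ler0n R 2) (ler0n R c)) (mulr_ge0 s0 S0).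
  have : nB ^+ 2 <= (2 * c%:R * (s * SR)) ^+ 2 by rewrite ler_sqr ?nnegrE.
  have cs0 : 0 <= 4 * c%:R ^+ 2 * s ^+ 2 by rewrite !mulr_ge0 ?sqr_ge0.
  have := ler_wpM2l cs0 qS2.
  have := lattice; rewrite -(ltr_pM2l nB0) => lt1 le2.
  rewrite -(ler_pM2l q0); apply/negP; rewrite -ltNge.
  rewrite (_ : q * (_ ^+ 2) = 4 * c%:R ^+ 2 * s ^+ 2 * (q * SR ^+ 2)); last by ring.
  apply: le_lt_trans le2 _; rewrite (_ : q * nB ^+ 2 = nB * (q * nB)); last by ring.
  by apply: le_lt_trans lt1; rewrite mulrCA.
have [nV r_le] := rounding_in_space etas trV a_le1 aV c_gt0 thetaV r_half close.
pose tau := s * SR / nB.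
have tau0 : 0 <= tau := divr_ge0 (mulr_ge0 s0 S0) nB_ge0.
have r_tau b : `|ratr (r b)| <= tau :> R.
  rewrite /tau ler_pdivlMr // mulrC.
  by have := r_le b; rewrite -(ler_rat R) !rmorphM /= !ratr_nat ratr_norm SRE.
have tau2 : q * nB * tau ^+ 2 <= s ^+ 2 * rho.
  rewrite -(ler_pM2l nB0).
  have -> : nB * (q * nB * tau ^+ 2) = s ^+ 2 * (q * SR ^+ 2).
    by rewrite /tau; field; rewrite gt_eqF.
  by rewrite [leRHS]mulrCA ler_wpM2l ?sqr_ge0.
have qnB : 0 < q * nB by rewrite mulr_gt0.
have tau4 : tau <= 4^-1.
  have : (4 * tau) ^+ 2 <= 1 ^+ 2.
    rewrite -(ler_pM2l qnB); lra.
  have t0 := mulr_ge0 (ler0n R 4) tau0.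
  by rewrite ler_sqr ?nnegrE //; lra.
have tau_rho : 2048 * (tau * rho) <= 1.
  have : (2048 * (tau * rho)) ^+ 2 <= 1 ^+ 2.
    rewrite -(ler_pM2l qnB) expr1n mulr1; apply: le_trans cubic.
    have -> : q * nB * (2048 * (tau * rho)) ^+ 2 =
        2048 ^+ 2 * rho ^+ 2 * (q * nB * tau ^+ 2) by ring.
    have -> : 2048 ^+ 2 * s ^+ 2 * rho ^+ 3 = 2048 ^+ 2 * rho ^+ 2 * (s ^+ 2 * rho).
      by ring.
    by rewrite ler_wpM2l // mulr_ge0 ?sqr_ge0.
  have t0 := mulr_ge0 (ler0n R 2048) (mulr_ge0 tau0 (ltW rho_gt0)).
  by rewrite ler_sqr ?nnegrE //.
have shift := @balanced_char_shift R B gamma (ratr p)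
  (fun b => ratr (theta b : rat)) n.
rewrite shift; last first.
  have gamma_r : \sum_b (gamma b)%:~R * r b = p * \sum_b r b.
    have := gammaV _ (memvB thetaV nV).
    under eq_bigr => b _ do rewrite !ffunE.
    by under [in RHS]eq_bigr => b _ do rewrite !ffunE.
  transitivity (ratr (\sum_b (gamma b)%:~R * r b) : R).
    rewrite rmorph_sum; apply: eq_bigr => b _.
    by rewrite ratr_r rmorphM /= ratr_int.
  rewrite gamma_r rmorphM rmorph_sum; congr (_ * _).
  by apply: eq_bigr => b _; rewrite ratr_r.
have [||re0 _] := @Re_prod_centered_ge R B (ratr p)
    (fun b => ratr (theta b : rat) - (n b)%:~R) p01'.
- by move=> b; rewrite ratr_r; apply: le_trans tau4.
- apply: le_trans tau_rho; rewrite -/q -mulrA ler_pM2l //.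
  apply: (@le_trans _ _ (q * (tau * Q))).
    rewrite ler_pM2l // mulr_sumr; apply: ler_sum => b _; rewrite ratr_r.
    by rewrite exprS real_normK ?num_real // ler_wpM2r ?sqr_ge0.
  by rewrite mulrCA ler_wpM2l // ltW.
by apply: le_trans re0; rewrite oppr_le0 expR_ge0.
Qed.

Lemma Re_balanced_char_box (R : realType) (B : finType)
    (gamma : {ffun B -> int}) (p tau : R) (theta : B -> R) :
  0 <= p <= 1 ->
  \sum_b (gamma b)%:~R * theta b = p * \sum_b theta b ->
  (forall b, `|theta b| <= tau) -> 0 <= tau <= 4^-1 ->
  2048 * (p * (1 - p) * #|B|%:R) * tau ^+ 3 <= 1 ->
  96 * (p * (1 - p) * #|B|%:R) * tau ^+ 2 <= 1 ->
  3^-1 <= complex.Re (balanced_char gamma p theta).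
Proof.
move=> p01 gamma_p theta_le /andP[tau0 tau4] cubic square.
have shift := @balanced_char_shift R B gamma p theta (fun=> 0).
rewrite shift => /=; last first.
  under eq_bigr => b _ do rewrite subr0.
  by under [in RHS]eq_bigr => b _ do rewrite subr0.
under eq_bigr => b _ do rewrite subr0.
have q0 : 0 <= p * (1 - p).
  by have /andP[? ?] := p01; rewrite mulr_ge0 // subr_ge0.
have moment k : p * (1 - p) * \sum_b `|theta b| ^+ k <=
    p * (1 - p) * #|B|%:R * tau ^+ k.
  rewrite -[leRHS]mulrA ler_wpM2l // mulr_natl -sumr_const; apply: ler_sum => b _.
  by rewrite lerXn2r ?nnegrE.
have square_le : p * (1 - p) * \sum_b theta b ^+ 2 <=
    p * (1 - p) * #|B|%:R * tau ^+ 2.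
  apply: le_trans (moment 2); rewrite ler_wpM2l //; apply: ler_sum => b _.
  by rewrite real_normK ?num_real.
have [b||_] := @Re_prod_centered_ge R B p theta p01.
- exact: le_trans (theta_le b) _.
- by have := moment 3; lra.
- by apply: le_trans; lra.
Qed.

(** * Powers against logarithms *)

Lemma ln_le_tangent (R : realType) (a y : R) : 0 < a -> 0 < y ->
  ln y <= y / a + ln a.
Proof.
move=> a0 y0; have ya : 0 < y / a by rewrite divr_gt0.
rewrite -{1}(divfK (lt0r_neq0 a0) y) lnM ?posrE // lerD2r.
by apply/ltW/ln_sublinear.
Qed.

Lemma ln2_ge_half (R : realType) : 2^-1 <= ln 2 :> R.
Proof.
rewrite -ler_expR lnK ?posrE //.
have : 1 + - 2^-1 <= expR (- 2^-1) :> R by apply: expR_ge1Dx.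
rewrite expRN; have e0 := expR_gt0 (2^-1 : R).
rewrite -[X in X <= _](_ : 2^-1 = _) ?lef_pV2 ?posrE //; lra.
Qed.

(** Take logarithms and absorb the [s] on the right by means of the tangent line of
    [ln] at [12 * d * c]. *)
Lemma exponent_le (R : realType) (s c d : nat) :
  (0 < c)%N -> (0 < d)%N -> (2 ^ s <= (2 * c * s).+1 ^ d)%N ->
  s%:R <= 4 * d%:R * ln (12 * d%:R * c%:R) :> R.
Proof.
move=> c0 d0 le_s.
have cR : 1 <= c%:R :> R by rewrite ler1n.
have dR : 1 <= d%:R :> R by rewrite ler1n.
have a1 : 1 <= 12 * d%:R * c%:R :> R by nra.
case: s le_s => [|s] le_s; first by rewrite mulr_ge0 ?ln_ge0 // mulr_ge0.
have sR : 1 <= s.+1%:R :> R by rewrite ler1n.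
have : s.+1%:R * ln 2 <= d%:R * ln (3 * c%:R * s.+1%:R) :> R.
  rewrite !mulr_natl -!lnXn //; last by nra.
  rewrite ler_ln ?posrE ?exprn_gt0 //; last by nra.
  apply: (@le_trans _ _ ((2 * c * s.+1).+1 ^ d)%N%:R).
    by rewrite -natrX ler_nat.
  rewrite natrX lerXn2r ?nnegrE //; first by nra.
  by rewrite -natr1 !natrM; nra.
have : ln (3 * c%:R * s.+1%:R) <=
    s.+1%:R / (4 * d%:R) + ln (12 * d%:R * c%:R) :> R.
  have -> : s.+1%:R / (4 * d%:R) =
      (3 * c%:R * s.+1%:R) / (12 * d%:R * c%:R) :> R.
    by field; rewrite !gt_eqF //; lra.
  by apply: ln_le_tangent; nra.
set y := ln (3 * _ * _); set z := ln (12 * _ * _) => y_le sx_le.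
have x_ge := ln2_ge_half R.
have y_le' : d%:R * y <= s.+1%:R / 4 + d%:R * z.
  have -> : s.+1%:R / 4 + d%:R * z = d%:R * (s.+1%:R / (4 * d%:R) + z).
    by field; rewrite gt_eqF //; lra.
  by rewrite ler_wpM2l.
have : s.+1%:R * 2^-1 <= s.+1%:R * ln 2 :> R by rewrite ler_wpM2l.
lra.
Qed.

(** After raising to the sixth power, five factors [Y] pay for [A] and [d] and
    one for the logarithm, as [Y = expR (ln Y / 30) ^+ 30 >= (ln Y / 30) ^+ 30]. *)
Lemma ln_pow5_absorbed (R : realType) (A d Y : R) :
  1 <= A -> 1 <= d -> A ^+ 2 * 30 ^+ 6 * d ^+ 6 <= Y ->
  A * d ^+ 5 * ln Y ^+ 5 <= Y.
Proof.
have [b bE] : exists b : R, b = 30%:R by exists 30%:R.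
have b1 : 1 <= b by rewrite bE ler1n.
rewrite -[30]bE => A1 d1 Y_ge.
have [A0 d0 b0] : [/\ 0 <= A, 0 <= d & 0 <= b] by split; lra.
have Y1 : 1 <= Y.
  by apply: le_trans Y_ge; rewrite !mulr_ege1 ?exprn_ege1.
have Y0 : 0 < Y by lra.
have L0 : 0 <= ln Y by apply: ln_ge0.
have Y_exp : (ln Y / b) ^+ 30 <= Y.
  have {2}-> : Y = expR (ln Y / b) ^+ 30.
    by rewrite -expRM_natl -bE mulrC divfK ?lnK ?posrE // gt_eqF //; lra.
  rewrite lerXn2r ?nnegrE ?expR_ge0 ?divr_ge0 //.
  by apply: le_trans (expR_ge1Dx _); rewrite lerDr.
have Y_pow : (A ^+ 2 * b ^+ 6 * d ^+ 6) ^+ 5 <= Y ^+ 5.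
  by rewrite lerXn2r ?nnegrE ?(ltW Y0) // !mulr_ge0 ?exprn_ge0.
rewrite -(@ler_pXn2r _ 6) ?nnegrE ?(ltW Y0) //; last first.
  by rewrite !mulr_ge0 ?exprn_ge0.
rewrite [leRHS]exprSr; apply: le_trans (ler_pM _ _ Y_pow Y_exp); first last.
- by rewrite exprn_ge0 // divr_ge0.
- by rewrite exprn_ge0 // !mulr_ge0 ?exprn_ge0.
rewrite [leRHS](_ : _ = (A * d ^+ 5 * ln Y ^+ 5) ^+ 6 * A ^+ 4); last first.
  by field; rewrite gt_eqF //; lra.
by rewrite ler_peMr ?exprn_ege1 // exprn_ge0 // !mulr_ge0 ?exprn_ge0.
Qed.

(** The quantity [7 * d * c2 * N] is the inverse of the radius of a box of
    frequencies; its logarithm involves [N] itself, so the hypothesis has to be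
    turned into a bound with [N] on both sides.  Write [N = c3 ^+ 2 * Y].  The
    logarithm is at most [2 * (ln Y + ln (2 * c3 * d))]; the first summand is
    absorbed by a power of [Y], the second by the logarithm in the
    hypothesis. *)
Lemma polylog_absorbed (R : realType) (K : R) : 1 <= K ->
  exists2 C : R, 0 < C &
  forall d c2 c3 N : R, 1 <= d -> 1 <= c2 -> 1 <= c3 ->
  C * c2 * c3 ^+ 2 * d ^+ 6 * ln (2 * c3 * d) ^+ 6 <= N ->
  [/\ 7 <= N, 1 <= ln (7 * d * c2 * N) &
      K * c3 ^+ 2 * d ^+ 5 * ln (7 * d * c2 * N) ^+ 5 <= N].
Proof.
move=> K1; have [b bE] : exists b : R, b = 30%:R by exists 30%:R.
have [A AE] : exists A : R, A = 2 ^+ 11 * K by exists (2 ^+ 11 * K).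
have b1 : 1 <= b by rewrite bE ler1n.
have A_ge : 8 <= A by rewrite AE; lra.
have A0 : 0 <= A by lra.
(* [64] makes up for the logarithm, which is at least one half, to the sixth
   power; in [A], [(2 + 2) ^ 5 = 2 ^ 10] comes from [E_le], and one factor 2
   lets each of two summands be at most half of [Y] *)
exists (64 * A ^+ 2 * b ^+ 6); first by rewrite !mulr_gt0 ?exprn_gt0; lra.
move=> d c2 c3 N d1 c21 c31.
set l := ln _ => N_ge.
have d0 : 0 <= d by lra.
have b0 : 0 <= b by lra.
have c20 : 0 <= c2 by lra.
have l_ge : 2^-1 <= l.
  apply: le_trans (ln2_ge_half R) _; rewrite ler_ln ?posrE //; nra.
have l0 : 0 <= l by lra.
have c32 : 1 <= c3 ^+ 2 by rewrite exprn_ege1.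
have [Y NE] : exists Y, N = c3 ^+ 2 * Y.
  by exists (N / c3 ^+ 2); rewrite mulrC divfK // gt_eqF //; lra.
have d6 : 1 <= d ^+ 6 by rewrite exprn_ege1.
have b6 : 1 <= b ^+ 6 by rewrite exprn_ege1.
have Y_ge : 64 * A ^+ 2 * b ^+ 6 * c2 * d ^+ 6 * l ^+ 6 <= Y.
  have c3_gt0 : 0 < c3 ^+ 2 by lra.
  by rewrite -(ler_pM2l c3_gt0) -NE; move: N_ge; congr (_ <= _); ring.
have l6 : 1 <= 64 * l ^+ 6.
  have -> : 64 * l ^+ 6 = (2 * l) ^+ 6 by ring.
  by rewrite exprn_ege1 //; lra.
have Y_ge1 : A ^+ 2 * b ^+ 6 * c2 * d ^+ 6 <= Y.
  apply: le_trans Y_ge.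
  have : 0 <= A ^+ 2 * b ^+ 6 * c2 * d ^+ 6 * (64 * l ^+ 6 - 1).
    by rewrite !mulr_ge0 ?exprn_ge0 // subr_ge0.
  lra.
have A2 : 7 <= A ^+ 2.
  by apply: (@le_trans _ _ (8 ^+ 2)); [lra | rewrite lerXn2r ?nnegrE //; lra].
have dc2 : 1 <= d * c2 by nra.
have Y_dc : 7 * d * c2 <= Y.
  apply: le_trans Y_ge1.
  have d_le : d <= b ^+ 6 * d ^+ 6.
    have d5 : 1 <= d ^+ 5 by rewrite exprn_ege1.
    rewrite (exprS d 5); apply: (@le_trans _ _ (1 * (d * 1))); first by lra.
    by rewrite ler_pM ?ler_pM ?mulr_ge0 //; lra.
  rewrite (_ : _ * _ * d ^+ 6 = A ^+ 2 * c2 * (b ^+ 6 * d ^+ 6)); last by ring.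
  rewrite (_ : 7 * d * c2 = 7 * c2 * d); last by ring.
  by apply: ler_pM => //; [lra | apply: ler_wpM2r].
clear N_ge l6.
have Y2 : 2 <= Y by lra.
have N7 : 7 <= N.
  have Y7 : 7 <= Y by lra.
  by rewrite NE (_ : 7 = 1 * 7); [apply: ler_pM | rewrite mul1r].
have N2 : 2 <= N by lra.
have dcN : 14 <= 7 * d * c2 * N.
  have : 1 * 2 <= d * c2 * N by apply: ler_pM.
  lra.
have cd1 : 2 <= 2 * c3 * d by nra.
have E_le : ln (7 * d * c2 * N) <= 2 * (ln Y + l).
  rewrite /l -lnM ?posrE; [|lra|lra].
  have Ycd : 0 < Y * (2 * c3 * d) by apply: mulr_gt0; lra.
  rewrite [2 * _]mulr_natl -lnXn // ler_ln ?posrE ?exprn_gt0 //; last by lra.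
  rewrite NE (_ : (_ * _) ^+ 2 = Y * (c3 ^+ 2 * Y) * (4 * d ^+ 2)); last by ring.
  have d2 : 1 <= 4 * d ^+ 2 by have := exprn_ege1 2 d1; lra.
  have cY : 0 <= c3 ^+ 2 * Y by apply: mulr_ge0; lra.
  apply: (@le_trans _ _ (Y * (c3 ^+ 2 * Y))); first exact: ler_wpM2r.
  by rewrite ler_peMr // mulr_ge0 //; lra.
have E_ge : 1 <= ln (7 * d * c2 * N).
  apply: (@le_trans _ _ (ln (2 ^+ 2))).
    by rewrite lnXn // mulr2n; have := ln2_ge_half R; lra.
  by rewrite ler_ln ?posrE; lra.
split=> //.
have L0 : 0 <= ln Y by apply: ln_ge0; lra.
have d5 : 1 <= d ^+ 5 by rewrite exprn_ege1.
have l_part : A * d ^+ 5 * l ^+ 5 <= Y.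
  apply: le_trans Y_ge.
  rewrite [leRHS](_ : _ =
    A * d ^+ 5 * l ^+ 5 * (64 * A * b ^+ 6 * c2 * d * l)); last by ring.
  rewrite ler_peMr //; first by rewrite !mulr_ge0 ?exprn_ge0.
  have Al : 1 <= 64 * A * l.
    have : 8 * 2^-1 <= A * l by apply: ler_pM; lra.
    lra.
  have bc : 1 <= b ^+ 6 * c2 by apply: mulr_ege1.
  rewrite [leRHS](_ : _ = (64 * A * l) * (b ^+ 6 * c2 * d)); last by ring.
  by rewrite mulr_ege1 // mulr_ege1.
have L_part : A * d ^+ 5 * ln Y ^+ 5 <= Y.
  apply: ln_pow5_absorbed => //; first by lra.
  apply: le_trans Y_ge1; rewrite -[30]bE.
  rewrite [leRHS](_ : _ = A ^+ 2 * b ^+ 6 * d ^+ 6 * c2); last by ring.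
  by rewrite ler_peMr // !mulr_ge0 ?exprn_ge0.
rewrite [leRHS]NE.
rewrite (_ : K * _ * _ * _ =
  c3 ^+ 2 * (K * d ^+ 5 * ln (7 * d * c2 * N) ^+ 5)); last by ring.
rewrite ler_wpM2l ?sqr_ge0 //.
have E5 : ln (7 * d * c2 * N) ^+ 5 <= 2 ^+ 10 * (ln Y ^+ 5 + l ^+ 5).
  pose m := Num.max (ln Y) l.
  have m0 : 0 <= m by rewrite le_max L0.
  apply: (@le_trans _ _ ((4 * m) ^+ 5)).
    rewrite lerXn2r ?nnegrE ?mulr_ge0 //; first by lra.
    apply: le_trans E_le _.
    have : ln Y <= m by rewrite le_max lexx.
    have : l <= m by rewrite le_max lexx orbT.
    lra.
  rewrite exprMn (_ : 4 ^+ 5 = 2 ^+ 10); last by ring.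
  rewrite ler_wpM2l ?exprn_ge0 // /m.
  by case: (leP (ln Y) l) => _; rewrite ?lerDl ?lerDr exprn_ge0.
have Kd : 0 <= K * d ^+ 5 by rewrite mulr_ge0 ?exprn_ge0 //; lra.
apply: le_trans (ler_wpM2l Kd E5) _.
by move: l_part L_part; rewrite AE; move: (ln Y ^+ 5) (l ^+ 5) (d ^+ 5) => *; lra.
Qed.

(** * Existence of balanced subsets *)

(** For [x] and [y] the sizes of a subset and of its complement, the middle term
    is the variance of the size of a random subset of mean size [x]. *)
Lemma half_min_le_harmonic (R : realFieldType) (x y : R) : 0 < x -> 0 < y ->
  Num.min x y / 2 <= x * y / (x + y) <= Num.min x y.
Proof.
move=> x0 y0; case: (leP x y) => le_xy; apply/andP; split;
  rewrite ?ler_pdivlMr ?ler_pdivrMr ?addr_gt0 //; nra.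
Qed.

(** The box makes up a fraction [m%:R ^- d] of the grid, so its contribution
    outweighs the error [eps] on the rest. *)
Lemma grid_sum_gt0 (R : realFieldType) (d m K : nat)
    (g : {ffun 'I_d -> 'I_(m * K)} -> R) (eps : R) :
  (0 < m)%N -> (0 < K)%N -> m%:R ^+ d * eps < 3^-1 ->
  (forall x : {ffun 'I_d -> 'I_(m * K)}, (forall i, (x i < K)%N) -> 3^-1 <= g x) ->
  (forall x, - eps <= g x) -> 0 <= eps ->
  0 < \sum_x g x.
Proof.
move=> m_gt0 K_gt0 small box lower eps0.
pose low : pred 'I_(m * K) := fun y => (y < K)%N.
have g_ge x : (x \in ffun_on low)%:R * 3^-1 - eps <= g x.
  case: ffun_onP => [/box gx|_]; last by rewrite mul0r sub0r.
  by rewrite mul1r; apply: le_trans gx; rewrite gerBl.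
apply: lt_le_trans (ler_sum _ (fun x _ => g_ge x)).
have -> : \sum_(x : {ffun 'I_d -> 'I_(m * K)})
    ((x \in ffun_on low)%:R * 3^-1 - eps) =
    (#|low| ^ d)%:R * 3^-1 - (m%:R ^+ d * eps) * (K ^ d)%:R.
  rewrite sumrB -mulr_suml sumr_const card_ffun !card_ord expnMn.
  congr (_ * _ - _); last by rewrite -[LHS]mulr_natr natrM !natrX; ring.
  rewrite -[in RHS](card_ord d) -card_ffun_on -sum1_card natr_sum [RHS]big_mkcond.
  by apply: eq_bigr => x _; case: (x \in _).
have K_low : (K <= #|low|)%N.
  have K_le : (K <= m * K)%N by rewrite leq_pmull.
  rewrite -[K in (K <= _)%N]card_ord.
  have widen_inj : injective (widen_ord K_le).
    by move=> y z /(congr1 val) /= /val_inj.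
  rewrite -(card_image widen_inj).
  by apply/subset_leq_card/subsetP => _ /imageP[y _ ->]; rewrite unfold_in /=.
have Kd : 0 < (K ^ d)%:R :> R by rewrite ltr0n expn_gt0 K_gt0.
have lowd : (K ^ d)%:R <= (#|low| ^ d)%:R :> R.
  by rewrite !natrX lerXn2r ?nnegrE ?ler_nat.
have := small; rewrite -(ltr_pM2r Kd); lra.
Qed.

(** Were there no such set, the characteristic function would have sum zero over a
    grid fine enough to detect nonzero integral pairings.  But its real part is
    at least one third on a small box around the origin and at least
    [- expR (- (rho / 2))] everywhere, where [rho = 4 * d * ln m] is chosen
    such that [expR (- (rho / 2)) = m%:R ^- (2 * d)] is negligible against
    the proportion [m%:R ^- d] of the box in the grid. *)
Lemma exists_balanced_subset (R : realType) (B : finType) (V : {vspace ratfun B})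
    (c2 c3 n : nat) (gamma : {ffun B -> int}) :
  let N := minn n (#|B| - n) in let d := \dim V in
  let E : R := ln (7 * d%:R * c2%:R * N%:R) in
  has_bounded_integer_basis (@linfty_norm B) c2 V ->
  has_bounded_integer_basis (@l1_norm B) c3 (ortho_compl V) ->
  (forall b1 b2 : B, exists2 s : {perm B}, is_symmetry V s & s b1 = b2) ->
  (forall f, f \in V -> \sum_b (gamma b)%:~R * (f b : rat) =
     n%:R / #|B|%:R * \sum_b (f b : rat)) ->
  (0 < c2)%N -> (0 < c3)%N -> (0 < d)%N -> (7 <= N)%N -> 1 <= E ->
  2 ^+ 33 * c3%:R ^+ 2 * d%:R ^+ 5 * E ^+ 5 <= N%:R ->
  exists T : {set B}, forall f, f \in V ->
    \sum_(t in T) (f t : rat) = n%:R / #|B|%:R * \sum_b (f b : rat).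
Proof.
move=> N d E V_basis ortho_basis trV gammaV c2_gt0 c3_gt0 d_gt0 N7 E1 large.
have [F [F_le FV F_gen]] := bounded_integer_basis V_basis.
have [D [a [a_le1 aV D_small]]] := unit_coordinates V_basis.
have N_le_n : (N <= n)%N by rewrite geq_minl.
have N_le_Bn : (N <= #|B| - n)%N by rewrite geq_minr.
have nB : (n < #|B|)%N by lia.
have N_gt0 : (0 < N)%N by apply: leq_trans N7.
pose p : rat := n%:R / #|B|%:R.
have BQ_gt0 : 0 < #|B|%:R :> rat by rewrite ltr0n; lia.
have p01 : 0 < p < 1.
  have n_gt0 : 0 < n%:R :> rat by rewrite ltr0n; lia.
  by rewrite divr_gt0 //= ltr_pdivrMr // mul1r ltr_nat.
(* frequencies with [x i < K] give [`|theta b| <= d * c2 / m = (7 * N)^-1];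
   [K] exceeds the absolute values of all pairings *)
pose m := (7 * d * c2 * N)%N; pose K := (c2 * #|B|).+1.
have m_ge7 : (7 <= m)%N by rewrite /m -!mulnA leq_pmulr // !muln_gt0 d_gt0 c2_gt0.
have m_gt0 : (0 < m)%N by apply: leq_trans m_ge7.
pose q : R := ratr p * (1 - ratr p).
have BR_gt0 : 0 < #|B|%:R :> R by rewrite ltr0n; lia.
have pR : ratr p = n%:R / #|B|%:R :> R by rewrite fmorph_div /= !ratr_nat.
have [qB_ge qB_le] : N%:R / 2 <= q * #|B|%:R /\ q * #|B|%:R <= N%:R.
  pose x : R := n%:R; pose y : R := (#|B| - n)%N%:R.
  have xy : #|B|%:R = x + y :> R by rewrite -natrD subnKC // ltnW.
  have x0 : 0 < x by rewrite ltr0n; lia.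
  have y0 : 0 < y by rewrite ltr0n; lia.
  have -> : q * #|B|%:R = x * y / (x + y).
    by rewrite /q pR xy -/x; field; rewrite gt_eqF // addr_gt0.
  have -> : N%:R = Num.min x y :> R.
    by rewrite /N /x /y; case: (leqP n (#|B| - n)) => le_n;
      [rewrite min_l | rewrite min_r]; rewrite ?ler_nat // ltnW.
  by have /andP[] := half_min_le_harmonic x0 y0.
pose rho : R := 4 * d%:R * E.
have mE : m%:R = 7 * d%:R * c2%:R * N%:R :> R by rewrite /m !natrM.
have D_rho : #|D|%:R <= rho.
  apply: le_trans (exponent_le R c2_gt0 d_gt0 D_small) _.
  rewrite /rho ler_pM2l ?mulr_gt0 ?ltr0n // /E -(natrM R 12) -natrM -mE.
  rewrite ler_ln ?posrE ?ltr0n ?muln_gt0 ?d_gt0 ?c2_gt0 // ler_nat.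
  rewrite -mulnA (_ : m = 7 * N * (d * c2))%N; last first.
    by rewrite /m -(mulnA 7) -mulnA (mulnC (d * c2)%N) mulnA.
  by rewrite leq_mul2r (leq_trans _ (leq_mul (leqnn 7) N7)) // orbT.
pose theta (x : {ffun 'I_d -> 'I_(m * K)}) : ratfun B :=
  (m * K)%:R^-1 *: \sum_i (x i)%:R *: int_to_rat_vec (F i).
have thetaV x : theta x \in V.
  by rewrite memvZ // memv_suml // => i _; rewrite memvZ.
have thetaE x b : ratr (theta x b : rat) = grid_point R F x b.
  have -> : theta x b = (m * K)%:R^-1 * \sum_i (x i)%:R * (F i b)%:~R :> rat.
    rewrite !ffunE sum_ffunE; congr (_ * _).
    by apply: eq_bigr => i _; rewrite !ffunE.
  rewrite rmorphM fmorphV rmorph_sum /= ratr_nat mulr_sumr; apply: eq_bigr => i _.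
  by rewrite [ratr (_ * _)]rmorphM /= ratr_nat ratr_int mulrCA [_^-1 * _]mulrC.
pose chi x : R := complex.Re
  (balanced_char gamma (ratr p) (fun b => ratr (theta x b : rat))).
(* [#|D| <= rho = 4 * y], so the three conditions relating [#|D|], [rho] and the
   variance follow from the hypothesis on [c3 ^+ 2 * y ^+ 5] *)
pose y : R := d%:R * E; have y1 : 1 <= y by rewrite mulr_ege1 ?ler1n.
have rhoE : rho = 4 * y by rewrite /rho mulrA.
have [W_le z_le w_le] : [/\ 2 ^+ 33 * (c3%:R ^+ 2 * y ^+ 5) <= N%:R,
    c3%:R ^+ 2 * y ^+ 3 <= c3%:R ^+ 2 * y ^+ 5 & y ^+ 5 <= c3%:R ^+ 2 * y ^+ 5].
  have c3_ge1 : 1 <= c3%:R ^+ 2 :> R by rewrite exprn_ege1 ?ler1n.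
  split.
    by rewrite /y exprMn (mulrA (c3%:R ^+ 2)) (mulrA (2 ^+ 33)) (mulrA (2 ^+ 33)).
    by rewrite ler_wpM2l ?sqr_ge0 // ler_weXn2l.
  by rewrite ler_peMl // exprn_ge0 //; lra.
have y5_gt0 : 0 < y ^+ 5 by rewrite exprn_gt0 //; lra.
have y35 : y ^+ 3 <= y ^+ 5 by rewrite ler_weXn2l.
have rho0 : 0 <= rho by rewrite rhoE; lra.
have D2 : #|D|%:R ^+ 2 <= rho ^+ 2 by rewrite lerXn2r ?nnegrE.
have lower x : - expR (- (rho / 2)) <= chi x.
  apply: (Re_balanced_char_ge ortho_basis trV a_le1 aV gammaV c3_gt0 p01
    (thetaV x)).
  - apply: lt_le_trans qB_ge.
    apply: (@le_lt_trans _ _ (4 * c3%:R ^+ 2 * rho ^+ 2 * rho)).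
      by rewrite ler_wpM2r // ler_wpM2l // mulr_ge0 ?sqr_ge0.
    rewrite rhoE (_ : _ * _ = 256 * (c3%:R ^+ 2 * y ^+ 3)); last by ring.
    move: W_le z_le w_le y5_gt0.
    move: (c3%:R ^+ 2 * y ^+ 3) (c3%:R ^+ 2 * y ^+ 5) (y ^+ 5).
    by move=> *; lra.
  - apply: le_trans qB_ge; apply: (@le_trans _ _ (16 * rho ^+ 2 * rho)).
      by rewrite ler_wpM2r // ler_wpM2l.
    rewrite rhoE (_ : _ * _ = 1024 * y ^+ 3); last by ring.
    move: W_le w_le y5_gt0 y35; move: (y ^+ 3) (c3%:R ^+ 2 * y ^+ 5) (y ^+ 5).
    by move=> *; lra.
  - apply: le_trans qB_ge; apply: (@le_trans _ _ (2048 ^+ 2 * rho ^+ 2 * rho ^+ 3)).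
      by rewrite ler_wpM2r ?exprn_ge0 // ler_wpM2l ?exprn_ge0.
    rewrite rhoE (_ : _ * _ = 2 ^+ 32 * y ^+ 5); last by ring.
    move: W_le w_le y5_gt0; move: (c3%:R ^+ 2 * y ^+ 5) (y ^+ 5) => *.
    lra.
have F_norm i b : `|(F i b)%:~R| <= c2%:R :> R.
  by rewrite -intr_norm -[c2%:R]/(c2%:Z%:~R) ler_int -abszE lez_nat.
have box (x : {ffun 'I_d -> 'I_(m * K)}) : (forall i, (x i < K)%N) -> 3^-1 <= chi x.
  move=> x_small.
  have [tau tauE] : exists tau : R, tau = (7 * N%:R)^-1 by exists (7 * N%:R)^-1.
  have NR : 7 <= N%:R :> R by rewrite ler_nat.
  have tauN : tau * (7 * N%:R) = 1 by rewrite tauE mulVf // gt_eqF //; lra.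
  have tau0 : 0 < tau by rewrite tauE invr_gt0; lra.
  have tau_le : tau <= 49^-1 by nra.
  have mK_gt0 : 0 < (m * K)%:R :> R by rewrite ltr0n muln_gt0 m_gt0.
  have theta_tau b : `|ratr (theta x b : rat) : R| <= tau.
    rewrite thetaE; apply: le_trans (ler_norm_sum _ _ _) _.
    have -> : tau = \sum_(i < d) K%:R * (c2%:R / (m * K)%:R).
      rewrite sumr_const card_ord tauE -[RHS]mulr_natr natrM mE.
      by field; rewrite !pnatr_eq0 -!lt0n N_gt0 c2_gt0 d_gt0.
    apply: ler_sum => i _; rewrite normrM normr_nat normrM normfV normr_nat.
    apply: ler_pM => //; first by rewrite mulr_ge0 // invr_ge0 ltW.
      by rewrite ler_nat ltnW.
    by rewrite ler_pM2r ?invr_gt0.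
  apply: (@Re_balanced_char_box _ _ _ _ tau) => //.
  - have /andP[p0 p1] := p01.
    by rewrite ler0q -(rmorph1 (@ratr R)) ler_rat !ltW.
  - under eq_bigr => b _ do rewrite -(ratr_int R) -rmorphM.
    by rewrite -!rmorph_sum -rmorphM gammaV.
  - by apply/andP; split; lra.
  - apply: (@le_trans _ _ (2048 * N%:R * tau ^+ 3)).
      by rewrite ler_wpM2r ?exprn_ge0 ?(ltW tau0) // ler_wpM2l.
    rewrite (_ : _ * tau ^+ 3 = 2048 / 7 * tau ^+ 2 * (tau * (7 * N%:R))).
      have : tau ^+ 2 <= 49^-1 ^+ 2.
        by rewrite lerXn2r ?nnegrE ?invr_ge0 ?(ltW tau0).
      by rewrite tauN; lra.
    by field.
  - apply: (@le_trans _ _ (96 * N%:R * tau ^+ 2)).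
      by rewrite ler_wpM2r ?sqr_ge0 // ler_wpM2l.
    rewrite (_ : _ * tau ^+ 2 = 96 / 7 * tau * (tau * (7 * N%:R))).
      by rewrite tauN; lra.
    by field.
have eps_small : m%:R ^+ d * expR (- (rho / 2)) < 3^-1 :> R.
  have -> : rho / 2 = (2 * d)%:R * ln m%:R by rewrite mE natrM /rho /E; field.
  rewrite expRN expRM_natl lnK ?posrE ?ltr0n // mulnC exprM expr2 invfM mulrA.
  rewrite divff ?mul1r ?expf_neq0 ?pnatr_eq0 ?gtn_eqF //.
  rewrite ltf_pV2 ?posrE ?exprn_gt0 ?ltr0n //.
  apply: (@lt_le_trans _ _ m%:R); first by rewrite ltr_nat; apply: leq_trans m_ge7.
  by rewrite ler_eXnr ?ler1n.
have := grid_sum_gt0 m_gt0 (ltn0Sn _) eps_small box lower (expR_ge0 _).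
apply: contraPP => no_T.
suff -> : \sum_x chi x = 0 by rewrite ltxx.
have <- : complex.Re (\sum_(x : {ffun 'I_d -> 'I_(m * K)})
    balanced_char gamma (ratr p) (grid_point R F x)) = \sum_x chi x.
  rewrite (big_morph (@complex.Re R) (id1 := 0) (op1 := +%R)) //; last first.
    by case=> [? ?] [? ?].
  apply: eq_bigr => x _; congr complex.Re; apply: eq_bigr => b _.
  by rewrite !thetaE.
rewrite sum_balanced_char_eq0 // => T.
apply: contrapT => all_zero; apply: no_T; exists T => f fV.
pose w : ratfun B := [ffun b => (b \in T)%:R - (gamma b)%:~R : rat^o].
have dot_w g : g \in V ->
    dotQ g w = \sum_(t in T) (g t : rat) - p * \sum_b (g b : rat).
  move=> gV; rewrite -gammaV // big_mkcond -sumrB; apply: eq_bigr => b _.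
  rewrite ffunE mulrBr [_ * (gamma b)%:~R]mulrC.
  by case: (b \in T); rewrite ?mulr1 ?mulr0.
apply/eqP; rewrite -subr_eq0 -/p -dot_w //; apply/eqP.
apply: F_gen fV => i.
pose k := \sum_b ((b \in T)%:Z - gamma b) * F i b.
have kE : dotQ (int_to_rat_vec (F i)) w = k%:~R.
  rewrite rmorph_sum; apply: eq_bigr => b _.
  by rewrite !ffunE rmorphM rmorphB /= mulrC; case: (b \in T).
have k_lt : `|k| < (m * K)%:Z.
  rewrite -(ltr_int rat) intr_norm -kE dot_w // big_mkcond mulr_sumr -sumrB.
  apply: le_lt_trans (ler_norm_sum _ _ _) _.
  apply: (@le_lt_trans _ _ (\sum_(b : B) c2%:R)).
    apply: ler_sum => b _; rewrite ffunE; have /andP[p0 p1] := p01.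
    have Fb : `|(F i b)%:~R| <= c2%:R :> rat.
      by rewrite -intr_norm -[c2%:R]/(c2%:Z%:~R) ler_int -abszE lez_nat.
    apply: le_trans Fb; case: (b \in T).
      rewrite -{1}[_%:~R]mul1r -mulrBl normrM ler_piMl // ger0_norm; lra.
    by rewrite sub0r normrN normrM ler_piMl // ger0_norm; lra.
  rewrite sumr_const -mulrnA -[X in _ < X]/((m * K)%:R) ltr_nat.
  exact: leq_pmull.
rewrite kE; apply/eqP; rewrite intr_eq0; apply/negPn/negP => k0.
by apply: all_zero; exists i; rewrite normr_gt0 k0.
Qed.

Theorem theorem2p4 (R : realType) :
  exists2 C : R, 0 < C &
  forall (B : finType) (V : {vspace ratfun B}) (c1 c2 c3 : nat),
  (1 <= c1)%N -> (1 <= c2)%N -> (1 <= c3)%N ->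
  is_divisibility_constant V c1 ->
  has_bounded_integer_basis (@linfty_norm B) c2 V ->
  has_bounded_integer_basis (@l1_norm B) c3 (ortho_compl V) ->
  (forall b1 b2 : B, exists2 pi : {perm B}, is_symmetry V pi & pi b1 = b2) ->
  (forall a : rat, [ffun=> a] \in V) ->
  forall N : int, (c1%:Z %| N)%Z ->
  C * c2%:R * c3%:R ^+ 2 * (\dim V)%:R ^+ 6
    * ln (2 * c3%:R * (\dim V)%:R) ^+ 6
    <= (Num.min N (#|B|%:Z - N))%:~R ->
  exists2 T : {set B}, #|T|%:Z = N &
  forall f : ratfun B, f \in V ->
    (#|T|%:R)^-1 * \sum_(t in T) (f t : rat) =
    (#|B|%:R)^-1 * \sum_b (f b : rat).
Proof.
have [|C C_gt0 absorb] := @polylog_absorbed R (2 ^+ 33).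
  by rewrite exprn_ege1 ?ler1n.
exists C => // B V c1 c2 c3 _ c2_gt0 c3_gt0 [_ c1_div] V_basis ortho_basis.
move=> trV constV N c1N large.
(* on an empty set the inequality only allows N = 0 *)
have [B0|B_neq0] := eqVneq #|B| 0%N.
  have sum0 (P : pred B) (F : B -> rat) : \sum_(b | P b) F b = 0.
    by rewrite big1 // => b; have := card0_eq B0 b.
  exists set0; last by move=> f _; rewrite !sum0 !mulr0.
  have : 0 <= Num.min N (#|B|%:Z - N).
    rewrite -(ler_int R); apply: le_trans large.
    by rewrite mulr_ge0 ?exprn_even_ge0 // !mulr_ge0 ?exprn_ge0 ?ler0n ?(ltW C_gt0).
  by rewrite B0 cards0 le_min; lia.
have d_gt0 : (0 < \dim V)%N.
  rewrite lt0n dimv_eq0; apply: contraNneq B_neq0 => V0.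
  have : ([ffun=> 1] : ratfun B) \in V := constV 1.
  rewrite V0 memv0 => /eqP/ffunP one0.
  by apply/eqP/eq_card0 => b; have := one0 b; rewrite !ffunE.
have [||| N7 E1 N_ge] := absorb _ _ _ _ _ _ _ large; rewrite ?ler1n //.
have {}N7 : 7 <= Num.min N (#|B|%:Z - N) by rewrite -(ler_int R).
have [n nE] : exists n : nat, N = n by exists `|N|%N; lia.
subst N.
have minE : Num.min n%:Z (#|B|%:Z - n%:Z) = (minn n (#|B| - n))%:Z by lia.
rewrite minE in N7 E1 N_ge.
have [gamma gammaV] := (c1_div n).2 c1N.
have [T TV] := exists_balanced_subset V_basis ortho_basis trV gammaV
  c2_gt0 c3_gt0 d_gt0 N7 E1 N_ge.
have B_gt0 : #|B|%:R != 0 :> rat by rewrite pnatr_eq0.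
have T_card : #|T| = n.
  have := TV _ (constV 1); under eq_bigr do rewrite ffunE.
  under [in RHS]eq_bigr do rewrite ffunE.
  by rewrite !sumr_const divfK // => /eqP; rewrite eqr_nat => /eqP.
exists T; first by rewrite T_card.
move=> f fV; rewrite TV // T_card mulrA mulrA mulVf ?mul1r // pnatr_eq0.
by lia.
Qed.
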